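(* Let $k$ be a field of characteristic $0$, let $Q=P(x_1,x_2,\ldots,x_n)$ be the free Poisson field over $k$ in the variables $x_1,x_2,\ldots,x_n$, and let $Q^e$ be its universal enveloping algebra. Then $Q^e$ satisfies the weak algorithm for the degree function $\mathrm{hdeg}$, and $Q^e$ is a free ideal ring.
   Context: A Poisson algebra over $k$ is a $k$-vector space $P$ with two bilinear operations $x\cdot y$ and $\{x,y\}$ such that $P$ is a commutative associative algebra under $\cdot$, a Lie algebra under $\{\cdot,\cdot\}$, and $\{x,y\cdot z\}=\{x,y\}\cdot z+y\cdot\{x,z\}$. Free Poisson field: let $g=\mathrm{Lie}\langle x_1,\ldots,x_n\rangle$ be the free Lie algebra over $k$ with a multihomogeneous linear basis $e_1,e_2,\ldots$ beginning with $x_1,\ldots,x_n$. The free Poisson algebra $P\langle x_1,\ldots,x_n\rangle$ is the polynomial algebra $k[e_1,e_2,\ldots]$ with the unique Poisson bracket satisfying $\{e_i,e_j\}=[e_i,e_j]$. The free Poisson field $P(x_1,\ldots,x_n)$ is its field of fractions with the unique extension of the Poisson bracket. Universal enveloping algebra: for a Poisson algebra $P$, $P^e$ is the associative unital $k$-algebra generated by two copies $m_P=\{m_a\mid a\in P\}$ and $h_P=\{h_a\mid a\in P\}$ of the vector space $P$ (with $a\mapsto m_a$, $a\mapsto h_a$ linear), with defining relations $m_{xy}=m_xm_y$, $h_{\{x,y\}}=h_xh_y-h_yh_x$, $h_{xy}=m_yh_x+m_xh_y$, $m_{\{x,y\}}=h_xm_y-m_yh_x$ for all $x,y\in P$, and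 $m_1=1$. The map $a\mapsto m_a$ is injective and $m_a$ is identified with $a$. Degree function: every nonzero $u\in Q^e$ can be uniquely written as $u=\sum_{i=1}^s q_iw_i$ with $0\neq q_i\in Q$ and $w_1,\ldots,w_s$ distinct words $h_{x_{i_1}}h_{x_{i_2}}\cdots h_{x_{i_r}}$ ($r\ge 0$, the empty word being $1$); $\mathrm{hdeg}\,u$ is the maximal length of the words $w_i$, and $\mathrm{hdeg}\,0=-\infty$. Weak algorithm: $Q^e$ satisfies the weak algorithm for $\mathrm{hdeg}$ if for any finite set of nonzero left $Q^e$-dependent elements $s_1,\ldots,s_m\in Q^e$ (i.e. $\sum_r u_rs_r=0$ for some $u_r\in Q^e$, not all zero) with $\mathrm{hdeg}(s_1)\le\cdots\le\mathrm{hdeg}(s_m)$ there exist $i$, $1\le i\le m$, and $v_1,\ldots,v_{i-1}\in Q^e$ such that $\mathrm{hdeg}(s_i-v_1s_1-\cdots-v_{i-1}s_{i-1})<\mathrm{hdeg}(s_i)$ and $\mathrm{hdeg}(v_j)+\mathrm{hdeg}(s_j)\le\mathrm{hdeg}(s_i)$ for all $1\le j\le i-1$; and the analogous property holds for right dependence (with relations $\sum_r s_ru_r=0$ and combinations $s_i-s_1v_1-\cdots-s_{i-1}v_{i-1}$). A free ideal ring is a ring in which every left ideal is a free left module of unique rank and every right ideal is a free right module of unique rank. *)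

(* Defs.v *)
From HB Require Import structures.
From mathcomp Require Import all_boot all_order all_algebra.
From mathcomp Require Import finmap.
From mathcomp Require Import boolp classical_sets functions cardinality.
From mathcomp Require Import constructive_ereal.
From mathcomp Require Import -(notations) monalg.

Set Implicit Arguments.
Unset Strict Implicit.
Unset Printing Implicit Defensive.

Import Order.TTheory GRing.Theory Num.Theory.
Local Open Scope ring_scope.

(* The notations of monalg are incompatible with those of mathcomp-analysis. *)
Local Notation "{ 'malg' G [ K ] }" := (@malg K G) : type_scope.
Local Notation "{ 'cmonom' I }" := (cmonom I) : type_scope.
Local Notation "{ 'fmonom' I }" := (fmonom I) : type_scope.
Local Notation "<< i >>" := (mkmalgU i 1) : ring_scope.

(* Throughout, {malg A[K]} (finitely supported functions K -> A) is used for
   coordinate families of formal linear combinations; {malg k[{cmonom I}]} is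
   the commutative polynomial ring k[X_i | i : I], and {malg k[{fmonom T}]} the
   free associative unital k-algebra on the set T. *)

(* Fields that are k-algebras; fieldExtType only covers finite extensions. *)
#[short(type="fieldAlgType")]
HB.structure Definition FieldAlgebra (k : fieldType) :=
  {A of GRing.Field A & GRing.Algebra k A}.

Record lie_bracket (k : fieldType) (L : lmodType k) (br : L -> L -> L) : Prop :=
  LieBracket {
    lie_linearl : forall z : L, linear (fun y => br y z);
    lie_linearr : forall z : L, linear (br z);
    lie_alt : forall y : L, br y y = 0;
    lie_jacobi : forall y z t : L,
      br y (br z t) + br z (br t y) + br t (br y z) = 0 }.

Record poisson_bracket (k : fieldType) (P : comAlgType k) (br : P -> P -> P) :
  Prop := PoissonBracket {
    poisson_lie : lie_bracket br;
    poisson_leibniz : forall y z t : P, br y (z * t) = br y z * t + z * br y t }.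

Definition lie_hom (L L' : Type) (br : L -> L -> L) (br' : L' -> L' -> L')
  (f : L -> L') : Prop := forall y z, f (br y z) = br' (f y) (f z).

Definition free_lie_algebra (k : fieldType) (n : nat) (g : lmodType k)
    (br : g -> g -> g) (x : 'I_n -> g) : Prop :=
  lie_bracket br /\
  forall (L : lmodType k) (brL : L -> L -> L), lie_bracket brL ->
  forall y : 'I_n -> L, exists f : {linear g -> L},
    [/\ lie_hom br brL f, forall i, f (x i) = y i &
        forall f' : {linear g -> L},
          lie_hom br brL f' -> (forall i, f' (x i) = y i) -> f' =1 f].

Inductive lie_monomial (k : fieldType) (n : nat) (g : lmodType k)
    (br : g -> g -> g) (x : 'I_n -> g) : {ffun 'I_n -> nat} -> g -> Prop :=
| LieMonomialVar i :
    lie_monomial br x [ffun j => (j == i : nat)] (x i)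
| LieMonomialBr (d d' : {ffun 'I_n -> nat}) u u' :
    lie_monomial br x d u -> lie_monomial br x d' u' ->
    lie_monomial br x [ffun j => (d j + d' j)%N] (br u u').

Definition multihomogeneous (k : fieldType) (n : nat) (g : lmodType k)
    (br : g -> g -> g) (x : 'I_n -> g) (u : g) : Prop :=
  exists (d : {ffun 'I_n -> nat}) (c : {malg k[g]}),
    (forall v, v \in msupp c -> lie_monomial br x d v) /\
    u = \sum_(v <- msupp c) mcoeff v c *: v.

Definition linear_basis (k : fieldType) (V : lmodType k) (I : choiceType)
    (e : I -> V) : Prop :=
  forall v : V, exists! c : {malg k[I]}, v = \sum_(i <- msupp c) mcoeff i c *: e i.

Definition pvar (k : fieldType) (I : choiceType) (i : I) :
  {malg k[{cmonom I}]} := << ucm i >>.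

(* br is the bracket of the free Poisson algebra k[e_i | i : I] attached to the
   basis e of the Lie algebra g: the bracket of the variables e_i and e_j is the
   linear form obtained by expanding [e_i, e_j] in the basis e. *)
Definition free_poisson_bracket (k : fieldType) (g : lmodType k)
    (brg : g -> g -> g) (I : choiceType) (e : I -> g)
    (br : {malg k[{cmonom I}]} -> {malg k[{cmonom I}]} -> {malg k[{cmonom I}]}) :
    Prop :=
  poisson_bracket br /\
  forall (i j : I) (c : {malg k[I]}),
    brg (e i) (e j) = \sum_(l <- msupp c) mcoeff l c *: e l ->
    br (pvar k i) (pvar k j) = \sum_(l <- msupp c) mcoeff l c *: pvar k l.

Definition field_of_fractions (k : fieldType) (P : comAlgType k)
    (Q : fieldAlgType k) (iota : {lrmorphism P -> Q}) : Prop :=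
  injective iota /\
  forall q : Q, exists a b : P, iota b != 0 /\ q = iota a / iota b.

(* Q, with the bracket br, is the free Poisson field P(x_1, ..., x_n). The basis
   e is indexed by an arbitrary type I, in which v i is the index of x_i. *)
Definition free_poisson_field (k : fieldType) (n : nat) (Q : fieldAlgType k)
    (br : Q -> Q -> Q) (x : 'I_n -> Q) : Prop :=
  exists (g : lmodType k) (brg : g -> g -> g) (xg : 'I_n -> g)
         (I : choiceType) (e : I -> g) (v : 'I_n -> I)
         (brP : {malg k[{cmonom I}]} -> {malg k[{cmonom I}]} ->
                {malg k[{cmonom I}]})
         (iota : {lrmorphism {malg k[{cmonom I}]} -> Q}),
    [/\ free_lie_algebra brg xg,
        [/\ linear_basis e, forall i, multihomogeneous brg xg (e i) &
            forall i, e (v i) = xg i],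
        free_poisson_bracket brg e brP,
        field_of_fractions iota &
        [/\ poisson_bracket br,
            forall a b, br (iota a) (iota b) = iota (brP a b) &
            forall i, x i = iota (pvar k (v i))]].

Inductive generated_ideal (R : nzRingType) (S : R -> Prop) : R -> Prop :=
| GenIdeal0 : generated_ideal S 0
| GenIdealD a b :
    generated_ideal S a -> generated_ideal S b -> generated_ideal S (a + b)
| GenIdealM a r b : S r -> generated_ideal S (a * r * b).

Section Enveloping.
Variables (k : fieldType) (P : comAlgType k) (br : P -> P -> P).

Definition env_free : lalgType k := {malg k[{fmonom (P + P)%type}]}.
Definition env_m (a : P) : env_free := << fmu (inl a) >>.
Definition env_h (a : P) : env_free := << fmu (inr a) >>.

(* An element r of this set stands for the relation r = 0. *)
Inductive env_relation : env_free -> Prop :=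
| EnvLinM (c : k) a b : env_relation (env_m (c *: a + b) - (c *: env_m a + env_m b))
| EnvLinH (c : k) a b : env_relation (env_h (c *: a + b) - (c *: env_h a + env_h b))
| EnvMM a b : env_relation (env_m (a * b) - env_m a * env_m b)
| EnvHBr a b : env_relation (env_h (br a b) - (env_h a * env_h b - env_h b * env_h a))
| EnvHM a b : env_relation (env_h (a * b) - (env_m b * env_h a + env_m a * env_h b))
| EnvMBr a b : env_relation (env_m (br a b) - (env_h a * env_m b - env_m b * env_h a))
| EnvM1 : env_relation (env_m 1 - 1).

(* U, with the maps a |-> m_a and a |-> h_a, is P^e. *)
Definition universal_enveloping (U : algType k) (m h : P -> U) : Prop :=
  exists phi : {lrmorphism env_free -> U},
    [/\ forall a, phi (env_m a) = m a, forall a, phi (env_h a) = h a,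
        forall u, exists f, phi f = u &
        forall f, phi f = 0 <-> generated_ideal env_relation f].

End Enveloping.

Section HDegree.
Variables (k : fieldType) (n : nat) (Q : fieldAlgType k) (U : algType k).
Variables (m h : Q -> U) (x : 'I_n -> Q).

Definition hword (w : seq 'I_n) : U := \prod_(i <- w) h (x i).

Definition hexpansion (u : U) (c : {malg Q[(seq 'I_n)]}) : Prop :=
  u = \sum_(w <- msupp c) m (mcoeff w c) * hword w.

(* For Q^e each u has exactly one expansion, so the choice made by xget, and its
   default value, are irrelevant. The degree of 0 is -oo. *)
Definition hdeg (u : U) : \bar int :=
  let c := xget 0 (hexpansion u) in
  \big[maxe/-oo%E]_(w <- msupp c) ((size w)%:Z)%:E.

End HDegree.

Definition left_dependent (R : nzRingType) (p : nat) (s : 'I_p -> R) : Prop :=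
  exists u : 'I_p -> R, (exists r, u r != 0) /\ \sum_r u r * s r = 0.

Definition left_weak_algorithm (R : nzRingType) (d : R -> \bar int) : Prop :=
  forall (p : nat) (s : 'I_p -> R),
    (forall i, s i != 0) -> left_dependent s ->
    (forall i j : 'I_p, (i <= j)%N -> (d (s i) <= d (s j))%E) ->
  exists (i : 'I_p) (v : 'I_p -> R),
    (d (s i - \sum_(j < p | (j < i)%N) v j * s j)%R < d (s i))%E /\
    forall j : 'I_p, (j < i)%N -> (d (v j) + d (s j) <= d (s i))%E.

(* Right-handed notions are the left-handed ones in the converse ring R^c. *)
Definition weak_algorithm (R : nzRingType) (d : R -> \bar int) : Prop :=
  left_weak_algorithm d /\ @left_weak_algorithm R^c d.

Definition left_ideal (R : nzRingType) (J : set R) : Prop :=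
  [/\ J 0, forall a b, J a -> J b -> J (a + b) & forall r a, J a -> J (r * a)].

Definition left_ideal_basis (R : nzRingType) (J B : set R) : Prop :=
  (B `<=` J)%classic /\
  forall y, J y -> exists! c : {malg R[R]},
    (forall b, b \in msupp c -> B b) /\ y = \sum_(b <- msupp c) mcoeff b c * b.

Definition left_fir (R : nzRingType) : Prop :=
  forall J : set R, left_ideal J ->
    (exists B, left_ideal_basis J B) /\
    forall B B', left_ideal_basis J B -> left_ideal_basis J B' -> (B #= B')%card.

Definition free_ideal_ring (R : nzRingType) : Prop :=
  left_fir R /\ left_fir R^c.

(* Main.v *)
Require Import Defs.
From HB Require Import structures.
From mathcomp Require Import all_boot all_order all_algebra.
From mathcomp Require Import finmap.
From mathcomp Require Import boolp classical_sets functions cardinality.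
From mathcomp Require Import constructive_ereal.
From mathcomp Require Import -(notations) monalg.
From mathcomp Require Import zify.

Set Implicit Arguments.
Unset Strict Implicit.
Unset Printing Implicit Defensive.

Import Order.TTheory GRing.Theory Num.Theory.
Local Open Scope ring_scope.

(** In [Q^e] the elements [h_i = h_{x_i}] satisfy [h_i a = a h_i + {x_i, a}] for
    [a] in [Q].  The point is that [Q^e] is the skew polynomial ring defined by
    these relations: it is free as a left [Q]-module on the words in the [h_i].
    Moving a coefficient across a word changes it only by shorter words, so the
    leading forms of [Q^e] multiply as in the free associative algebra over [Q]
    with central coefficients.  For such rings the weak algorithm and its
    consequences can be read off leading forms.

    Words span ([env_spanned]): the free Lie algebra [g] is generated by the
    [x_i], the map [a |-> h_a] sends brackets to commutators, and it is a
    derivation, which carries the property from [g] to polynomials and then to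
    fractions.

    Words are independent ([coordinate_action], [enveloping_calculus]): [Q^e] acts
    on functions from words to [Q].  Coefficients act by multiplication and [h_i]
    by the rule above.  An operator is needed for [h_a] with [a] arbitrary:
    freeness of [g] gives it on [g], and it extends as a derivation to polynomials
    ([derivation_poly]) and to their fractions ([derivation_frac]).  The relations
    of [Q^e] then hold because both sides are derivations that agree on [g]
    ([enveloping_derivation]).  Applying [u] to the indicator function of the
    empty word reads off the coefficients of [u].

    What remains is stated for any ring with a [leading_calculus], a notion that is
    left-right symmetric ([leading_calculus_converse]).  If leading forms cancel in
    [\sum_r u_r s_r], dividing on the left by a top word of one of the [u_r]
    rewrites the leading form of the corresponding [s_r] in terms of the others
    ([leading_reduction]): this is the weak algorithm.  A left ideal then has as
    basis lifts of those leading forms which do not come from smaller degrees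
    ([exists_basis]).  For the uniqueness of the rank, the weak algorithm brings a
    finite basis into a form without cancellation of leading forms, where the
    constant terms of the transition matrices between two bases give inverse
    matrices over [Q] ([invariant_rank]); infinite bases are all countable. *)

(** * The weak algorithm from leading forms *)

Section LeadingForms.
Variables (Q : fieldType) (I : finType).

Definition degree_below (R : nzRingType) (C : R -> seq I -> Q) (N : nat) (u : R) :=
  forall w, (N <= size w)%N -> C u w = 0.

(** [C u w] stands for the coefficient of [u] at the word [w].  The axioms describe
a ring filtered by word length whose leading forms multiply as in the free
associative algebra on [I] with central coefficients in [Q].  Products constrain
top coefficients only; this makes the notion stable under reversing all words
and passing to the converse ring, whereas the full multiplication table of an
enveloping algebra is not symmetric.  The boolean in [lc_bound] is there for
[ex_minn]. *)
Record leading_calculus (R : nzRingType) (C : R -> seq I -> Q) : Prop := {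
  lc_sub : forall u v w, C (u - v) w = C u w - C v w;
  lc_bound : forall u, exists N, `[< degree_below C N u >];
  lc_inj : forall u, degree_below C 0 u -> u = 0;
  lc_lift : forall N (f : seq I -> Q),
    exists u, degree_below C N.+1 u /\ forall w, size w = N -> C u w = f w;
  lc_mul : forall a b u v, degree_below C a.+1 u -> degree_below C b.+1 v ->
    degree_below C (a + b).+1 (u * v) /\
    forall z, size z = (a + b)%N -> C (u * v) z = C u (take a z) * C v (drop a z)
}.

Variables (R : nzRingType) (C : R -> seq I -> Q).
Hypothesis HC : leading_calculus C.
Local Notation below := (degree_below C).

Lemma lc_zero w : C 0 w = 0.
Proof. by rewrite -(subrr (0 : R)) (lc_sub HC) subrr. Qed.

Lemma lc_opp u w : C (- u) w = - C u w.
Proof. by rewrite -[- u]sub0r (lc_sub HC) lc_zero sub0r. Qed.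

Lemma lc_add u v w : C (u + v) w = C u w + C v w.
Proof. by rewrite -[v]opprK (lc_sub HC) lc_opp !opprK. Qed.

Lemma lc_sum (T : Type) (r : seq T) (P : pred T) (F : T -> R) w :
  C (\sum_(i <- r | P i) F i) w = \sum_(i <- r | P i) C (F i) w.
Proof.
by apply: (big_morph (fun u => C u w)) => [u v|]; [exact: lc_add | exact: lc_zero].
Qed.

(** The degree plus one, as for [size] of polynomials: [0] has size [0], and degrees
are handled in [nat].  Two nonzero factors of sizes [p] and [q] have a product of
degree [p + q - 2]. *)
Definition sz (u : R) : nat := ex_minn (lc_bound HC u).

Lemma below_leq M N u : (M <= N)%N -> below M u -> below N u.
Proof. by move=> le_MN Mu w le_Nw; apply: Mu; apply: leq_trans le_Nw. Qed.

Lemma szP u N : (sz u <= N)%N <-> below N u.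
Proof.
rewrite /sz; case: ex_minnP => m /asboolP mu min_m; split=> [le_mN | Nu].
  exact: below_leq mu.
by apply: min_m; apply/asboolP.
Qed.

Lemma sz_below u : below (sz u) u. Proof. exact/szP. Qed.

Lemma sz_gt0 u : (0 < sz u)%N = (u != 0).
Proof.
apply/idP/idP => [|nz_u].
  by apply: contraTneq => ->; rewrite -leqNgt; apply/szP => w _; rewrite lc_zero.
by rewrite ltnNge; apply: contraNN nz_u => /szP/(lc_inj HC) ->.
Qed.

Lemma sz0 : sz 0 = 0%N.
Proof. by apply/eqP; rewrite -leqn0 leqNgt sz_gt0 eqxx. Qed.

Lemma sz_top u : u != 0 -> exists2 w, size w = (sz u).-1 & C u w != 0.
Proof.
rewrite -sz_gt0 => u_gt0; apply: contrapT => H.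
have: (sz u <= (sz u).-1)%N; last by lia.
apply/szP => w le_w; apply/eqP; apply: contrapT => /negP Cw; case: H.
exists w => //; apply/eqP; rewrite eqn_leq le_w andbT -ltnS prednK //.
by rewrite ltnNge; apply: contraNN Cw => /sz_below ->.
Qed.

Lemma below_sum (T : Type) (r : seq T) (P : pred T) (F : T -> R) N :
  (forall i, P i -> below N (F i)) -> below N (\sum_(i <- r | P i) F i).
Proof. by move=> H w Nw; rewrite lc_sum big1 // => i Pi; exact: H. Qed.

Lemma below_sub N u v : below N u -> below N v -> below N (u - v).
Proof. by move=> Nu Nv w Nw; rewrite (lc_sub HC) Nu ?Nv ?subrr. Qed.

Lemma below_add N u v : below N u -> below N v -> below N (u + v).
Proof. by move=> Nu Nv w Nw; rewrite lc_add Nu ?Nv ?addr0. Qed.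

Lemma below_mul N u v : u = 0 \/ v = 0 \/ (sz u + sz v <= N.+1)%N -> below N (u * v).
Proof.
move=> H; have [->|nz_u] := eqVneq u 0; first by move=> w _; rewrite mul0r lc_zero.
have [->|nz_v] := eqVneq v 0; first by move=> w _; rewrite mulr0 lc_zero.
have {H}Huv : (sz u + sz v <= N.+1)%N.
  by case: H => [/eqP|[/eqP|//]]; [rewrite (negPf nz_u) | rewrite (negPf nz_v)].
move: nz_u nz_v; rewrite -!sz_gt0 => u_gt0 v_gt0.
have [||uv _] := lc_mul HC (a := (sz u).-1) (b := (sz v).-1) (u := u) (v := v).
- by rewrite prednK //; exact: sz_below.
- by rewrite prednK //; exact: sz_below.
by apply: below_leq uv; lia.
Qed.

Lemma top_mul u v z : (0 < sz u)%N -> size z = ((sz u).-1 + (sz v).-1)%N ->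
  C (u * v) z = C u (take (sz u).-1 z) * C v (drop (sz u).-1 z).
Proof.
move=> u_gt0 size_z; have [->|nz_v] := eqVneq v 0.
  by rewrite mulr0 !lc_zero mulr0.
move: nz_v; rewrite -!sz_gt0 => v_gt0.
have [||_ E] := lc_mul HC (a := (sz u).-1) (b := (sz v).-1) (u := u) (v := v).
- by rewrite prednK //; exact: sz_below.
- by rewrite prednK //; exact: sz_below.
by rewrite E.
Qed.

(** The heart of the weak algorithm.  Choose a word [w] of top length with
coefficient [q != 0] in [u i].  Left division by [w], which maps [w ++ z] to [z]
and kills the words that do not begin with [w], commutes with right
multiplication on forms of degree at least [size w].  Since [s i] has maximal
degree among the products that reach the top degree [D], every [u r] involved has
degree at least [size w]; dividing the vanishing form of degree [D] of
[\sum_r u r * s r] by [w] therefore leaves [q] times the leading form of [s i]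
plus left multiples of the leading forms of the other [s r]. *)
Lemma leading_reduction (T : finType) (s u : T -> R) (D : nat) (i : T) :
  (forall r, s r != 0) ->
  (forall r, u r != 0 -> (sz (u r) + sz (s r) <= D.+2)%N) ->
  u i != 0 -> (sz (u i) + sz (s i) = D.+2)%N ->
  (forall r, u r != 0 -> (sz (u r) + sz (s r) = D.+2)%N ->
     (sz (s r) <= sz (s i))%N) ->
  below D (\sum_r u r * s r) ->
  exists v : T -> R, [/\ v i = 0,
    forall r, v r != 0 -> [/\ (sz (v r) + sz (s r) <= (sz (s i)).+1)%N,
                              u r != 0 & (sz (u r) + sz (s r) = D.+2)%N] &
    below (sz (s i)).-1 (s i - \sum_r v r * s r)].
Proof.
move=> nz_s leD nz_ui eqD max_i sum0.
have [w size_w nz_q] := sz_top nz_ui.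
set q := C (u i) w in nz_q.
(* the other indices whose product reaches the top degree *)
pose S r := [&& u r != 0, (sz (u r) + sz (s r) == D.+2)%N & r != i].
have: forall r, exists v : R, if S r then
    below (sz (u r) - (sz (u i)).-1) v /\
    forall z, size z = ((sz (u r)).-1 - (sz (u i)).-1)%N ->
      C v z = - q^-1 * C (u r) (w ++ z)
  else v = 0.
  move=> r; case SrE: (S r); last by exists 0.
  case/and3P: SrE => nz_ur /eqP eqDr ne_ri.
  have [v [v1 v2]] := lc_lift HC ((sz (u r)).-1 - (sz (u i)).-1)
                        (fun z => - q^-1 * C (u r) (w ++ z)).
  exists v; split=> //; apply: below_leq v1.
  have := max_i r nz_ur eqDr; move: nz_ur nz_ui; rewrite -!sz_gt0; lia.
move=> /choice[v Hv].
have Sv r : v r != 0 -> S r.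
  by apply: contraNT => /negPf Sr; have := Hv r; rewrite Sr => ->.
have le_v r : v r != 0 -> (sz (v r) <= sz (u r) - (sz (u i)).-1)%N.
  by move=> /Sv Sr; have := Hv r; rewrite Sr => -[/szP].
exists v; split.
- by have := Hv i; rewrite /S eqxx !andbF.
- move=> r nz_vr; have Sr := Sv r nz_vr; have vr := le_v r nz_vr.
  case/and3P: Sr => nz_ur /eqP eqDr ne_ri; split=> //.
  have := max_i r nz_ur eqDr; move: nz_ui nz_ur nz_vr; rewrite -!sz_gt0; lia.
have si_gt0 := nz_s i; rewrite -sz_gt0 in si_gt0.
have ui_gt0 := nz_ui; rewrite -sz_gt0 in ui_gt0.
move=> y; case: (leqP (sz (s i)) (size y)) => [lt_y _ | lt_y le_y].
  rewrite (lc_sub HC) sz_below // sub0r lc_sum big1 ?oppr0 // => r _.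
  have [->|nz_vr] := eqVneq (v r) 0; first by rewrite mul0r lc_zero.
  have Sr := Sv r nz_vr; have vr := le_v r nz_vr.
  case/and3P: Sr => nz_ur /eqP eqDr ne_ri.
  apply: (@below_mul (sz (s i))) => //; right; right.
  have := max_i r nz_ur eqDr; move: nz_ur nz_vr; rewrite -!sz_gt0; lia.
have size_y : size y = (sz (s i)).-1 by lia.
(* the coefficient at [w ++ y] is the one at [y] after division by [w] *)
have := sum0 (w ++ y); rewrite size_cat size_w size_y => /(_ ltac:(lia)).
rewrite lc_sum (bigD1 i) //= top_mul ?size_cat ?size_w ?size_y //.
rewrite take_size_cat // drop_size_cat // -/q => E.
rewrite (lc_sub HC) lc_sum (bigD1 i) //=.
have -> : v i = 0 by have := Hv i; rewrite /S eqxx !andbF.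
rewrite mul0r lc_zero add0r.
have -> : \sum_(r | r != i) C (v r * s r) y =
   - q^-1 * \sum_(r | r != i) C (u r * s r) (w ++ y).
  rewrite mulr_sumr; apply: eq_bigr => r ne_ri.
  have sr_gt0 := nz_s r; rewrite -sz_gt0 in sr_gt0.
  case SrE : (S r); last first.
    have := Hv r; rewrite SrE => ->; rewrite mul0r lc_zero.
    move: SrE; rewrite /S ne_ri andbT; case: eqVneq => [-> _|nz_ur /= /eqP ne].
      by rewrite mul0r lc_zero mulr0.
    rewrite (@below_mul D) ?mulr0 ?size_cat ?size_w ?size_y //; last lia.
    by right; right; have := leD r nz_ur; lia.
  have := Hv r; rewrite SrE => -[v1 v2].
  case/and3P: SrE => nz_ur /eqP eqDr _.
  have ur_gt0 := nz_ur; rewrite -sz_gt0 in ur_gt0.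
  have le_r := max_i r nz_ur eqDr.
  rewrite [RHS]mulrC (top_mul (u := u r)) ?size_cat ?size_w ?size_y //; last by lia.
  have [||_ Evs] := lc_mul HC (a := (sz (u r)).-1 - (sz (u i)).-1) (b := (sz (s r)).-1)
            (u := v r) (v := s r).
  - by apply: below_leq v1; lia.
  - by rewrite prednK //; exact: sz_below.
  - rewrite Evs ?size_y; last by lia.
    rewrite v2; last by rewrite size_take_min; lia.
    have -> : drop (sz (u r)).-1 (w ++ y) = drop ((sz (u r)).-1 - (sz (u i)).-1) y.
      by rewrite drop_cat size_w ltnNge; case: leqP => //=; lia.
    have -> : take (sz (u r)).-1 (w ++ y) =
              w ++ take ((sz (u r)).-1 - (sz (u i)).-1) y.
      by rewrite take_cat size_w ltnNge; case: leqP => //=; lia.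
    by rewrite -mulrA mulrC.
move: E => /(canRL (addKr _)); rewrite addr0 => ->.
by rewrite mulrN mulNr opprK mulKf // subrr.
Qed.

Definition edeg (u : R) : \bar int :=
  if u == 0 then -oo%E else ((sz u).-1%:Z)%:E.

Lemma edeg_le u v : (edeg u <= edeg v)%E = (sz u <= sz v)%N.
Proof.
rewrite /edeg; have [->|nz_u] := eqVneq u 0; first by rewrite sz0 leNye.
have [->|nz_v] := eqVneq v 0.
  by rewrite sz0 leqNgt sz_gt0 nz_u leeNy_eq.
by move: nz_u nz_v; rewrite -!sz_gt0 lee_fin; lia.
Qed.

Lemma edeg_lt u v : (edeg u < edeg v)%E = (sz u < sz v)%N.
Proof. by rewrite !ltNge edeg_le ltnNge. Qed.

Lemma edegD_le u v w : v != 0 -> w != 0 ->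
  (u != 0 -> (sz u + sz v <= (sz w).+1)%N) -> (edeg u + edeg v <= edeg w)%E.
Proof.
move=> nz_v nz_w; rewrite /edeg (negPf nz_v) (negPf nz_w).
have [->|nz_u /(_ isT)] := eqVneq u 0; first by rewrite addNye leNye.
move: nz_u nz_v nz_w; rewrite -!sz_gt0 -EFinD lee_fin; lia.
Qed.

(** [D] is the largest degree of the products: sizes exceed degrees by one for each
factor, whence the [D.+2]. *)
Lemma top_degree_of_products (T : finType) (s u : T -> R) :
  (forall r, s r != 0) -> (exists r, u r != 0) ->
  exists D, (forall r, u r != 0 -> (sz (u r) + sz (s r) <= D.+2)%N) /\
    exists2 r, u r != 0 & (sz (u r) + sz (s r) = D.+2)%N.
Proof.
move=> nz_s [r0 nz_r0].
have [r nz_r max_r] := arg_maxnP (P := fun r => u r != 0)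
  (fun r => sz (u r) + sz (s r))%N nz_r0.
have Hr : ((sz (u r) + sz (s r)).-2.+2 = sz (u r) + sz (s r))%N.
  by move: (nz_s r) nz_r; rewrite -!sz_gt0; lia.
by exists (sz (u r) + sz (s r)).-2; rewrite Hr; split; [exact: max_r | exists r].
Qed.

(** Reduce at the last index where the top degree is reached: by monotonicity its
[s i] is of maximal degree, and only earlier indices enter the combination. *)
Theorem leading_weak_algorithm : left_weak_algorithm edeg.
Proof.
move=> p s nz_s [u [nz_u sum0]] le_s.
have [D [leD [r0 nz_r0 eq_r0]]] := top_degree_of_products nz_s nz_u.
pose S r := (u r != 0) && (sz (u r) + sz (s r) == D.+2)%N.
have Sr0 : S r0 by rewrite /S nz_r0 eq_r0 eqxx.
have [i Si max_i] := arg_maxnP (P := S) (fun r : 'I_p => r : nat) Sr0.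
case/andP: (Si) => nz_i /eqP eq_i.
have [r nz_r eq_r||v [vi0 Hv lt_i]] := @leading_reduction _ s u D i nz_s leD nz_i eq_i.
- by rewrite -edeg_le; apply: le_s; apply: max_i; rewrite /S nz_r eq_r eqxx.
- by rewrite sum0 => w _; rewrite lc_zero.
exists i, v.
have -> : \sum_(j < p | (j < i)%N) v j * s j = \sum_j v j * s j.
  rewrite big_mkcond /=; apply: eq_bigr => j _; case: ltnP => // le_ij.
  have [->|nz_vj] := eqVneq (v j) 0; first by rewrite mul0r.
  have [_ nz_uj eq_j] := Hv j nz_vj.
  have le_ji : (j <= i)%N by apply: max_i; rewrite /S nz_uj eq_j eqxx.
  suff -> : j = i by rewrite vi0 mul0r.
  by apply/val_inj/eqP; rewrite eqn_leq le_ij le_ji.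
split.
  by rewrite edeg_lt; move/szP: lt_i; move: (nz_s i); rewrite -sz_gt0; lia.
by move=> j _; apply: edegD_le => // /Hv[].
Qed.

End LeadingForms.

(** * Bases of left ideals *)

Section Bases.
Variable R : nzRingType.
Implicit Types (J B : set R) (c : malg R R).

Lemma left_ideal_sum J (T : Type) (r : seq T) (P : pred T) (F : T -> R) :
  left_ideal J -> (forall i, P i -> J (F i)) -> J (\sum_(i <- r | P i) F i).
Proof. by case=> J0 JD _ JF; elim/big_ind: _ => // x y; exact: JD. Qed.

Definition combo c : R := \sum_(b <- msupp c) mcoeff b c * b.
Definition supported B c := forall b, b \in msupp c -> B b.

Lemma comboEw (d : {fset R}) c : {subset msupp c <= d} ->
  combo c = \sum_(b <- d) mcoeff b c * b.
Proof.
move=> sub_cd; apply: (mmapEw (f := idfun) (h := id) (d := d)).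
by apply/fsubsetP => b /sub_cd.
Qed.

Lemma comboB c c' : combo (c - c') = combo c - combo c'.
Proof. exact: (raddfB (mmap idfun id)). Qed.

Lemma combo0 : combo 0 = 0.
Proof. exact: (raddf0 (mmap idfun id)). Qed.

Lemma comboD c c' : combo (c + c') = combo c + combo c'.
Proof. exact: (raddfD (mmap idfun id)). Qed.

Lemma comboZ a c : combo (a *: c) = a * combo c.
Proof.
rewrite (comboEw (d := msupp c)) => [|b]; last exact: (fsubsetP (msuppZ_le a c)).
by rewrite mulr_sumr; apply: eq_bigr => b _; rewrite mcoeffZ mulrA.
Qed.

Lemma comboU a b : combo (mkmalgU b a) = a * b.
Proof. exact: (mmapU (f := idfun) (h := id)). Qed.

Lemma combo_sum (T : Type) (r : seq T) (P : pred T) (F : T -> malg R R) :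
  combo (\sum_(i <- r | P i) F i) = \sum_(i <- r | P i) combo (F i).
Proof. exact: (raddf_sum (mmap idfun id)). Qed.

Lemma supported0 B : supported B 0.
Proof. by move=> b; rewrite msupp0. Qed.

Lemma supportedD B c c' : supported B c -> supported B c' -> supported B (c + c').
Proof.
move=> Bc Bc' b /(fsubsetP (msuppD_le _ _)); rewrite in_fsetU.
by case/orP => [/Bc|/Bc'].
Qed.

Lemma supportedZ B a c : supported B c -> supported B (a *: c).
Proof. by move=> Bc b /(fsubsetP (msuppZ_le _ _)) /Bc. Qed.

Lemma supportedU B a b : B b -> supported B (mkmalgU b a).
Proof. by move=> Bb b' /(fsubsetP msuppU_le); rewrite in_fset1 => /eqP->. Qed.

Lemma supported_sum B (T : eqType) (r : seq T) (F : T -> malg R R) :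
  (forall i, i \in r -> supported B (F i)) -> supported B (\sum_(i <- r) F i).
Proof.
move=> H; rewrite big_seq; apply: (big_ind (supported B)) => //.
- exact: supported0.
- exact: supportedD.
Qed.

Definition lspan B : set R := [set y | exists c, supported B c /\ y = combo c]%classic.

Lemma lspan_ideal B : left_ideal (lspan B).
Proof.
split=> [|a b [c [Bc ->]] [c' [Bc' ->]]|r a [c [Bc ->]]].
- by exists 0; split; [exact: supported0 | rewrite combo0].
- by exists (c + c'); split; [exact: supportedD | rewrite comboD].
- by exists (r *: c); split; [exact: supportedZ | rewrite comboZ].
Qed.

Lemma lspan_sub B b : B b -> lspan B b.
Proof.
by move=> Bb; exists (mkmalgU b 1); split; [exact: supportedU | rewrite comboU mul1r].
Qed.

Definition lfree B := forall c, supported B c -> combo c = 0 -> c = 0.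

Lemma left_ideal_basisP J B : left_ideal J ->
  left_ideal_basis J B <-> [/\ (B `<=` J)%classic, (J `<=` lspan B)%classic & lfree B].
Proof.
case=> J0 JD JM; split=> [[BJ HB]|[BJ span_B free_B]].
  split=> // [y /HB[c [[Bc yc] _]]|c Bc c0]; first by exists c.
  have [c' [_ uniq_c']] := HB 0 J0.
  rewrite -(uniq_c' c) ?(uniq_c' 0) //; split=> //.
    exact: supported0.
  by rewrite -/(combo 0) combo0.
split=> // y Jy; have [c [Bc yc]] := span_B y Jy.
exists c; split=> // c' [Bc' yc'].
apply/eqP; rewrite -subr_eq0; apply/eqP/free_B; last first.
  by rewrite comboB -yc yc' subrr.
by apply: supportedD => //; rewrite -scaleN1r; exact: supportedZ.
Qed.

(** Otherwise some [b] occurs in none of the chosen expansions over [B] of the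
elements of [B']; substituting these in an expansion of [b] over [B'] gives an
expansion of [b] over [B] in which [b] does not occur. *)
Lemma lfree_cover B B' : lfree B -> (B `<=` lspan B')%classic ->
  (B' `<=` lspan B)%classic ->
  exists F : R -> {fset R}, (B `<=` \bigcup_(b in B') [set` F b])%classic.
Proof.
move=> free_B BB' B'B.
have : forall b', exists d, B' b' -> supported B d /\ b' = combo d.
  move=> b'; case: (pselect (B' b')) => [/B'B[d [Bd def]]|nB]; last by exists 0.
  by exists d.
move=> /choice[d Hd]; exists (fun b' => msupp (d b')) => b Bb.
have [c [B'c def_b]] := BB' b Bb.
pose c1 := \sum_(b' <- msupp c) mcoeff b' c *: d b'.
have Bc1 : supported B c1.
  by apply: supported_sum => b' /B'c/Hd[Bd _]; exact: supportedZ.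
have: mkmalgU b 1 - c1 = 0.
  apply: free_B.
    apply: supportedD; first exact: supportedU.
    by rewrite -scaleN1r; exact: supportedZ.
  rewrite comboB comboU mul1r combo_sum {1}def_b; apply/eqP; rewrite subr_eq0.
  apply/eqP; rewrite /combo big_seq [RHS]big_seq; apply: eq_bigr => b' cb'.
  by rewrite -/(combo _) comboZ; have [_ <-] := Hd b' (B'c _ cb').
move/eqP; rewrite subr_eq0 => /eqP def_c1.
have : b \in msupp c1 by rewrite -def_c1 msuppU oner_eq0 in_fset1.
rewrite -mcoeff_neq0 raddf_sum /= => nz.
apply: contrapT => Nb; case/negP: nz; rewrite big_seq; apply/eqP/big1 => b' cb'.
rewrite mcoeffZ; case: (msuppP (d b') b) => [bd|]; last by rewrite mulr0.
by case: Nb; exists b'; [exact: B'c | ].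
Qed.

Definition generating_family J (p : nat) (s : 'I_p -> R) :=
  forall y, J y -> exists u : 'I_p -> R, y = \sum_i u i * s i.
Definition free_family (p : nat) (s : 'I_p -> R) :=
  forall u : 'I_p -> R, \sum_i u i * s i = 0 -> forall i, u i = 0.

Lemma combo_nth (d : {fset R}) c : {subset msupp c <= d} ->
  combo c = \sum_(i < #|` d|) mcoeff (nth 0 d i) c * nth 0 d i.
Proof.
by move=> sub; rewrite (comboEw sub) (big_nth 0) big_mkord.
Qed.

Lemma finite_basis J B : left_ideal J -> left_ideal_basis J B -> finite_set B ->
  exists p (s : 'I_p -> R),
    [/\ B #= `I_p, forall i, J (s i), generating_family J s & free_family s]%card.
Proof.
move=> idJ /left_ideal_basisP[//|BJ span_B free_B] /finite_fsetP[d Bd].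
have dP b : B b <-> b \in d by rewrite Bd.
exists #|` d|, (fun i => nth 0 d i); split.
- by rewrite Bd; apply/card_eq_fsetP.
- by move=> i; apply/BJ/dP/mem_nth.
- move=> y /span_B[c [Bc ->]]; exists (fun i => mcoeff (nth 0 d i) c).
  by apply: combo_nth => b /Bc/dP.
- move=> u sum0 j.
  pose c : malg R R := \sum_(i < #|` d|) mkmalgU (nth 0 d i) (u i).
  have c0 : c = 0.
    apply: free_B.
      by apply: supported_sum => i _; apply: supportedU; apply/dP; exact: mem_nth.
    by rewrite combo_sum -[RHS]sum0; apply: eq_bigr => i _; rewrite comboU.
  have : mcoeff (nth 0 d j) c = u j.
    rewrite raddf_sum (bigD1 j) //= mcoeffUU big1 ?addr0 // => i ne_ij.
    rewrite mcoeffU nth_uniq ?fset_uniq //.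
    by rewrite (inj_eq val_inj) (negPf ne_ij) mulr0n.
  by rewrite c0 mcoeff0.
Qed.

End Bases.

(** The subspace of largest dimension contained in [P] absorbs every vector of [P]. *)
Lemma vspace_of_closed (K : fieldType) (V : vectType K) (P : V -> Prop) :
  P 0 -> (forall a u v, P u -> P v -> P (a *: u + v)) ->
  exists W : {vspace V}, forall v, v \in W <-> P v.
Proof.
move=> P0 Plin.
pose good d := `[< exists W : {vspace V}, \dim W = d /\ forall v, v \in W -> P v >].
have exg : exists d, good d.
  exists 0%N; apply/asboolP; exists 0%VS; rewrite dimv0; split=> // v.
  by rewrite memv0 => /eqP->.
have maxg d : good d -> (d <= \dim {:V})%N.
  by move=> /asboolP[W [<- _]]; exact/dimvS/subvf.
case: (ex_maxnP exg maxg) => d /asboolP[W [dimW WP]] max_d.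
exists W => v; split=> [/WP//|Pv].
have sub : (W <= W + <[v]>)%VS by exact: addvSl.
suff eqW : (W + <[v]>)%VS = W by rewrite -eqW; exact/(subvP (addvSr _ _))/memv_line.
apply/esym/eqP; rewrite eqEdim sub dimW; apply: max_d; apply/asboolP.
exists (W + <[v]>)%VS; split=> // x /memv_addP[w Ww [y /vlineP[a ->] ->]].
by rewrite addrC; apply: Plin => //; exact: WP.
Qed.

Lemma vbasis_notin_span_others (K : fieldType) (V : vectType K) (L W : {vspace V})
    (X := vbasis (L :\: W)%VS) (j : 'I_(\dim (L :\: W)%VS)) :
  X`_j \notin (W + \sum_(i | i != j) <[X`_i]>)%VS.
Proof.
apply/negP => /memv_addP[w Ww [y /memv_sumP[vs Hvs ->] def_j]].
have memX i : X`_i \in (L :\: W)%VS.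
  have [lt_i|le_i] := ltnP i (size X); first exact/vbasis_mem/mem_nth.
  by rewrite nth_default // mem0v.
have sumX : \sum_(i | i != j) vs i \in (L :\: W)%VS.
  by apply: memv_suml => i /Hvs/vlineP[c ->]; exact: memvZ.
have w0 : w = 0.
  apply/eqP; rewrite -memv0 -(capv_diff L W) memv_cap Ww andbT.
  by rewrite -[w](addrK (\sum_(i | i != j) vs i)) -def_j memvB.
have freeX : free X by exact: basis_free (vbasisP _).
have := coord_free j j freeX; rewrite eqxx def_j w0 add0r linear_sum big1 => [/eqP|i ne].
  by rewrite eq_sym oner_eq0.
have /vlineP[c ->] := Hvs i ne; rewrite linearZ /= coord_free //.
by rewrite (negPf ne) mulr0.
Qed.

(** * Left ideals are free of unique rank *)

Section FreeIdeals.
Variables (Q : fieldType) (I : finType) (R : nzRingType) (C : R -> seq I -> Q).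
Hypothesis HC : leading_calculus C.
Local Notation below := (degree_below C).
Local Notation sz := (sz HC).

(** Leading forms never cancel: no combination has degree smaller than one of its
terms (the d-independence of P. M. Cohn). *)
Definition degree_free (p : nat) (s : 'I_p -> R) :=
  forall u N, below N (\sum_i u i * s i) ->
    forall i, u i != 0 -> (sz (u i) + sz (s i) <= N.+1)%N.

Lemma free_family_neq0 (p : nat) (s : 'I_p -> R) : free_family s -> forall i, s i != 0.
Proof.
move=> free_s i; apply/eqP => si0.
have H : \sum_j (j == i)%:R * s j = 0.
  by apply: big1 => j _; case: eqP => [->|_]; rewrite ?si0 ?mulr0 ?mul0r.
have /eqP := free_s _ H i.
by rewrite eqxx oner_eq0.
Qed.

(** The substitution is undone by adding the same combination back. *)
Lemma elementary_transformation (J : set R) p (s v : 'I_p -> R) i : left_ideal J ->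
  v i = 0 -> (forall j, J (s j)) -> generating_family J s -> free_family s ->
  let s' j := if j == i then s i - \sum_r v r * s r else s j in
  [/\ forall j, J (s' j), generating_family J s' & free_family s'].
Proof.
move=> idJ vi0 Js gen_s free_s s'; have [J0 JD JM] := idJ.
have sumE (u : 'I_p -> R) :
    \sum_r u r * s' r = \sum_r (u r - u i * v r) * s r.
  rewrite (bigD1 i) //= /s' eqxx.
  rewrite [X in _ + X = _](eq_bigr (fun r => u r * s r)) => [|r /negPf->//].
  rewrite mulrBr [u i * s i - _]addrC -addrA.
  have <- : \sum_r u r * s r = u i * s i + \sum_(r | r != i) u r * s r.
    by rewrite (bigD1 i).
  rewrite addrC mulr_sumr -sumrB; apply: eq_bigr => r _.
  by rewrite mulrBl mulrA.
split.
- move=> j; rewrite /s'; case: eqP => // _; apply: JD => //.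
  rewrite -mulN1r; apply: (JM); apply: left_ideal_sum => // r _; exact: JM.
- move=> y /gen_s[u ->]; exists (fun r => u r + u i * v r); rewrite sumE.
  by apply: eq_bigr => r _; rewrite vi0 mulr0 addr0 addrK.
- move=> u; rewrite sumE => /free_s H.
  have ui0 : u i = 0 by have := H i; rewrite vi0 mulr0 subr0.
  by move=> r; have := H r; rewrite ui0 mul0r subr0.
Qed.

(** As long as leading forms cancel, [leading_reduction] supplies an elementary
transformation that lowers the degree of one element; the sum of the degrees
bounds the number of steps. *)
Lemma degree_free_basis (J : set R) p (s : 'I_p -> R) : left_ideal J ->
  (forall j, J (s j)) -> generating_family J s -> free_family s ->
  exists s' : 'I_p -> R,
    [/\ forall j, J (s' j), generating_family J s', free_family s' & degree_free s'].
Proof.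
move=> idJ; move: {2}(\sum_j sz (s j))%N.+1 (ltnSn (\sum_j sz (s j))%N) => m.
elim: m s => // m IH s; rewrite ltnS => le_m Js gen_s free_s.
have nz_s := free_family_neq0 free_s.
case: (pselect (degree_free s)) => [df|]; first by exists s.
move=> /existsNP[u /existsNP[N /not_implyP[uN /existsNP[r /not_implyP[nz_r lt_r]]]]].
have [D [leD [r0 nz_r0 eq_r0]]] := top_degree_of_products HC (u := u) nz_s (ex_intro _ r nz_r).
have ND : (N <= D)%N by have := leD r nz_r; lia.
pose S r := (u r != 0) && (sz (u r) + sz (s r) == D.+2)%N.
have Sr0 : S r0 by rewrite /S nz_r0 eq_r0 eqxx.
have [i Si max_i] := arg_maxnP (P := S) (fun r => sz (s r)) Sr0.
case/andP: (Si) => nz_i /eqP eq_i.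
have [t nz_t eq_t||v [vi0 Hv lt_i]] := leading_reduction (HC := HC) nz_s leD nz_i eq_i.
- by apply: max_i; rewrite /S nz_t eq_t eqxx.
- exact: below_leq uN.
have [Js' gen_s' free_s'] := elementary_transformation idJ vi0 Js gen_s free_s.
apply: (IH _ _ Js' gen_s' free_s').
apply: leq_trans le_m; rewrite (bigD1 i) //= [X in (_ < X)%N](bigD1 i) //= eqxx.
rewrite (eq_bigr (fun j => sz (s j))) => [|j /negPf->//].
rewrite ltn_add2r; move/(szP HC): lt_i => /leq_ltn_trans; apply.
by have := nz_s i; rewrite -(sz_gt0 HC); lia.
Qed.

(** If [w] is a top word of [1], then [1 = 1 * 1] has a nonzero coefficient at
[w ++ w]; hence [w] is empty and the constant term of [1] is an idempotent. *)
Lemma lc_one : C 1 [::] = 1.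
Proof.
have s1 : sz 1 = 1%N.
  have [w sw nz_w] := sz_top HC (oner_neq0 R).
  have g := oner_neq0 R; rewrite -(sz_gt0 HC) in g.
  have := top_mul (HC := HC) (u := 1) (v := 1) g (z := w ++ w); rewrite size_cat sw mulr1.
  move=> /(_ erefl); rewrite take_size_cat // drop_size_cat //.
  move: g sw; set N := sz 1 => g sw; case: (leqP 2 N) => [lt2|? _]; last by lia.
  rewrite (sz_below (HC := HC)) ?size_cat ?sw -/N; last by lia.
  by move/esym/eqP; rewrite mulf_eq0 (negPf nz_w).
have [w] := sz_top HC (oner_neq0 R); rewrite s1 => /size0nil -> nz.
have := top_mul (HC := HC) (u := 1) (v := 1) (z := [::]).
rewrite s1 mulr1 => /(_ isT erefl) /=.
by move/eqP; rewrite -{1}[C 1 [::]]mulr1 => /eqP/(mulfI nz) <-.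
Qed.

Lemma lc_mul_const u v : (sz u <= 1)%N -> (sz v <= 1)%N ->
  C (u * v) [::] = C u [::] * C v [::].
Proof.
by move=> /(szP HC) u1 /(szP HC) v1; have [_ ->] := lc_mul HC (a := 0) (b := 0) u1 v1.
Qed.

(** The coefficients that express two degree-free bases in each other respect
degrees.  Keeping only the constant terms of those that link elements of equal
degree gives matrices over the field [Q], and their product is still the
identity: in the constant term of [\sum_i a j i * b i l], for [t j] and [t l] of
the same degree, only the [s i] of that degree contribute. *)
Lemma transition_mx (J : set R) p q (s : 'I_p -> R) (t : 'I_q -> R) :
  (forall j, J (s j)) -> (forall j, J (t j)) ->
  generating_family J s -> generating_family J t -> free_family t ->
  degree_free s -> degree_free t ->
  exists (A : 'M[Q]_(q, p)) (B : 'M[Q]_(p, q)), A *m B = 1%:M.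
Proof.
move=> Js Jt gen_s gen_t free_t df_s df_t.
have /choice[a Ha] j := gen_s _ (Jt j).
have /choice[b Hb] i := gen_t _ (Js i).
exists (\matrix_(j, i) if sz (t j) == sz (s i) then C (a j i) [::] else 0).
exists (\matrix_(i, l) if sz (s i) == sz (t l) then C (b i l) [::] else 0).
have nz_t := free_family_neq0 free_t.
apply/matrixP => j l; rewrite !mxE.
have ab : \sum_i a j i * b i l = (j == l)%:R.
  apply/eqP; rewrite -subr_eq0; apply/eqP.
  apply: (free_t (fun l => \sum_i a j i * b i l - (j == l)%:R)).
  transitivity (\sum_i a j i * s i - t j); last by rewrite -Ha subrr.
  transitivity (\sum_i0 (\sum_i a j i * b i i0) * t i0 - \sum_i0 (j == i0)%:R * t i0).
    by rewrite -sumrB; apply: eq_bigr => i _; rewrite mulrBl.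
  congr (_ - _).
    under eq_bigr do rewrite mulr_suml.
    rewrite exchange_big /=; apply: eq_bigr => i _.
    by rewrite Hb mulr_sumr; apply: eq_bigr => i0 _; rewrite mulrA.
  rewrite (bigD1 j) //= eqxx mul1r big1 ?addr0 // => i; rewrite eq_sym => /negPf->.
  by rewrite mul0r.
have le_a i : a j i != 0 -> (sz (a j i) + sz (s i) <= (sz (t j)).+1)%N.
  by move=> nz; apply: df_s nz; rewrite -Ha; exact: sz_below.
have le_b i l' : b i l' != 0 -> (sz (b i l') + sz (t l') <= (sz (s i)).+1)%N.
  by move=> nz; apply: df_t nz; rewrite -Hb; exact: sz_below.
have [eq_jl|ne_jl] := eqVneq (sz (t j)) (sz (t l)); last first.
  rewrite big1 => [|i _]; first by rewrite [j == l](contraNF _ ne_jl) ?mulr0n // => /eqP->.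
  rewrite !mxE; case: eqP => [Ej|]; last by rewrite mul0r.
  by case: eqP => [El|]; [move: ne_jl; rewrite Ej El eqxx | rewrite mulr0].
transitivity (C (j == l)%:R [::]); last first.
  by case: eqP => _; [exact: lc_one | rewrite (lc_zero HC)].
rewrite -ab (lc_sum HC); apply: eq_bigr => i _; rewrite !mxE -eq_jl eq_sym.
case: eqVneq => [E|ne]; last first.
  rewrite mul0r; have [->|nz_a] := eqVneq (a j i) 0; first by rewrite mul0r (lc_zero HC).
  have [->|nz_b] := eqVneq (b i l) 0; first by rewrite mulr0 (lc_zero HC).
  have := le_a i nz_a; have := le_b i l nz_b; move: nz_a nz_b ne.
  by rewrite -!(sz_gt0 HC); lia.
rewrite lc_mul_const //.
  have [->|nz_a] := eqVneq (a j i) 0; first by rewrite sz0.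
  by have := le_a i nz_a; have := nz_t j; rewrite -(sz_gt0 HC); lia.
have [->|nz_b] := eqVneq (b i l) 0; first by rewrite sz0.
by have := le_b i l nz_b; have := nz_t j; rewrite -(sz_gt0 HC); lia.
Qed.

(** Both families are first reduced to degree-free ones, without changing their
lengths; these are then compared through ranks of matrices over [Q]. *)
Lemma invariant_rank (J : set R) p q (s : 'I_p -> R) (t : 'I_q -> R) :
  left_ideal J -> (forall j, J (s j)) -> (forall j, J (t j)) ->
  generating_family J s -> generating_family J t -> free_family s -> free_family t -> p = q.
Proof.
move=> idJ Js Jt gen_s gen_t free_s free_t.
have [s' [Js' gen_s' free_s' df_s']] := degree_free_basis idJ Js gen_s free_s.
have [t' [Jt' gen_t' free_t' df_t']] := degree_free_basis idJ Jt gen_t free_t.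
have le_rank m n (A : 'M[Q]_(m, n)) B : A *m B = 1%:M -> (m <= n)%N.
  move=> AB; rewrite -(mxrank1 Q m) -AB; apply: leq_trans (rank_leq_col A).
  exact: mxrankM_maxl.
have [A [B /le_rank pq]] := transition_mx Js' Jt' gen_s' gen_t' free_t' df_s' df_t'.
have [A' [B' /le_rank qp]] := transition_mx Jt' Js' gen_t' gen_s' free_s' df_t' df_s'.
by apply/eqP; rewrite eqn_leq pq qp.
Qed.

Definition lead e (u : R) : {ffun e.-tuple I -> Q^o} := [ffun z => C u (tval z)].

Lemma leadB e u v : lead e (u - v) = lead e u - lead e v.
Proof. by apply/ffunP => z; rewrite !ffunE (lc_sub HC). Qed.

Lemma leadD e u v : lead e (u + v) = lead e u + lead e v.
Proof. by apply/ffunP => z; rewrite !ffunE (lc_add HC). Qed.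

Lemma lead0 e : lead e 0 = 0.
Proof. by apply/ffunP => z; rewrite !ffunE (lc_zero HC). Qed.

Lemma lead_sum e (T : Type) (r : seq T) (P : pred T) (F : T -> R) :
  lead e (\sum_(i <- r | P i) F i) = \sum_(i <- r | P i) lead e (F i).
Proof. by apply: (big_morph (lead e)) => [u v|]; [exact: leadD | exact: lead0]. Qed.

Lemma lead_eq0 e u : (sz u <= e.+1)%N -> lead e u = 0 -> (sz u <= e)%N.
Proof.
move=> /(szP HC) u_e lead0; apply/(szP HC) => w; rewrite leq_eqVlt.
case/orP => [/eqP/esym/eqP sw|]; last exact: u_e.
by move/ffunP/(_ (Tuple sw)): lead0; rewrite !ffunE.
Qed.

Lemma constant_with_value (q : Q) : exists a : R, (sz a <= 1)%N /\ C a [::] = q.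
Proof.
have [a [a1 aq]] := lc_lift HC 0 (fun=> q).
by exists a; split; [exact/szP | exact: aq].
Qed.

Lemma lead_const e a u : (sz a <= 1)%N -> (sz u <= e.+1)%N ->
  (sz (a * u) <= e.+1)%N /\ lead e (a * u) = C a [::] *: lead e u.
Proof.
move=> /(szP HC) a1 /(szP HC) ue; have [ue' Eu] := lc_mul HC (a := 0) a1 ue.
split; first exact/szP.
by apply/ffunP => z; rewrite !ffunE Eu ?size_tuple // take0 drop0.
Qed.

Lemma leads_vspace (K : set R) e : left_ideal K ->
  exists W : {vspace {ffun e.-tuple I -> Q^o}}, forall f,
    f \in W <-> exists u, [/\ K u, (sz u <= e.+1)%N & lead e u = f].
Proof.
move=> [K0 KD KM]; apply: vspace_of_closed; first by exists 0; rewrite sz0 lead0.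
move=> q _ _ [u [Ku ue <-]] [v [Kv ve <-]].
have [a [a1 <-]] := constant_with_value q; have [aue Eau] := lead_const a1 ue.
exists (a * u + v); split; [by apply: KD; [exact: KM|]| |by rewrite leadD Eau].
by apply/(szP HC)/(below_add HC); exact/(szP HC).
Qed.

(** The left ideal generated by the elements of [J] of degree less than [e], in
impredicative form so that unfolding it is an induction principle. *)
Definition low_ideal (J : set R) e : set R :=
  [set u | forall K : set R, left_ideal K ->
             (forall s, J s -> (sz s <= e)%N -> K s) -> K u]%classic.

Lemma low_ideal_ideal J e : left_ideal (low_ideal J e).
Proof.
split=> [K [K0 _ _] //|u v Ku Kv K idK sub|r u Ku K idK sub].
  by have [_ KD _] := idK; apply: KD; [exact: Ku | exact: Kv].
by have [_ _ KM] := idK; apply: KM; exact: Ku.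
Qed.

(** Applied to a nontrivial relation, [leading_reduction] exhibits an element of [B]
whose leading form is a combination of those of the others. *)
Lemma lfree_of_leading (B : set R) : (forall b, B b -> b != 0) ->
  (forall p (s v : 'I_p -> R) i, injective s -> (forall r, B (s r)) -> v i = 0 ->
    (forall r, v r != 0 -> (sz (v r) + sz (s r) <= (sz (s i)).+1)%N) ->
    below (sz (s i)).-1 (s i - \sum_r v r * s r) -> False) ->
  lfree B.
Proof.
move=> nzB H c Bc c0; have [d0|nz_c] := eqVneq (msupp c) fset0.
  by rewrite (monalgE c) d0 big_seq_fset0.
exfalso.
pose d := msupp c; pose s (i : 'I_#|` d|) := nth 0 d i; pose u i := mcoeff (s i) c.
have ds i : s i \in d by exact: mem_nth.
have Bs i : B (s i) by exact: Bc.
have nz_s i : s i != 0 by exact: nzB.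
have nz_u i : u i != 0 by rewrite mcoeff_neq0.
have inj_s : injective s.
  by move=> i j /eqP; rewrite nth_uniq ?fset_uniq // => /eqP/val_inj.
have i0 : 'I_#|` d| by exists 0%N; rewrite cardfs_gt0.
have [D [leD [r0 nz_r0 eq_r0]]] := top_degree_of_products HC nz_s (ex_intro _ i0 (nz_u i0)).
pose S r := (sz (u r) + sz (s r) == D.+2)%N.
have Sr0 : S r0 by rewrite /S eq_r0 eqxx.
have [i /eqP eq_i max_i] := arg_maxnP (P := S) (fun r => sz (s r)) Sr0.
have [t nz_t eq_t||v [vi0 Hv lt_i]] :=
  leading_reduction (HC := HC) nz_s leD (nz_u i) eq_i.
- by apply: max_i; rewrite /S eq_t eqxx.
- by rewrite -(combo_nth (d := d)) // c0 => w _; rewrite (lc_zero HC).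
by apply: (H _ s v i inj_s Bs vi0 _ lt_i) => r /Hv[].
Qed.

(** In each degree [e], let [L e] be the space of leading forms of [J] and [W e] the
part of it that comes from elements of [J] of smaller degree.  Lifts to [J] of
bases of complements of [W e] in [L e], for all [e], form a basis of [J].  They
generate by induction on the degree.  They are free because a relation would
yield, by [leading_reduction], a vector of the basis of a complement inside the
sum of [W e] and the span of the other vectors.  The basis is countable, since
there are finitely many lifts in each degree. *)
Lemma exists_basis (J : set R) : left_ideal J ->
  exists B, left_ideal_basis J B /\ countable B.
Proof.
move=> idJ; have [J0 JD JM] := idJ.
have JN u : J u -> J (- u) by move=> Ju; rewrite -mulN1r; exact: JM.
have low_sub e : (low_ideal J e `<=` J)%classic by move=> u; apply.
pose L e := projT1 (cid (leads_vspace e idJ)).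
have HL e := projT2 (cid (leads_vspace e idJ)) : forall f, f \in L e <-> _.
pose W e := projT1 (cid (leads_vspace e (low_ideal_ideal J e))).
have HW e := projT2 (cid (leads_vspace e (low_ideal_ideal J e))) :
  forall f, f \in W e <-> _.
pose X e := vbasis (L e :\: W e)%VS.
pose d e := \dim (L e :\: W e)%VS.
have : forall ej : {e : nat & 'I_(d e)}, exists b,
    [/\ J b, (sz b <= (tag ej).+1)%N & lead (tag ej) b = (X (tag ej))`_(tagged ej)].
  move=> [e j] /=; apply/HL/(subvP (diffvSl _ (W e)))/vbasis_mem/mem_nth.
  by rewrite size_tuple.
move=> /choice[bb Hbb]; pose b e (j : 'I_(d e)) := bb (Tagged (fun e => 'I_(d e)) j).
have bJ e j : J (b e j) by case: (Hbb (Tagged (fun e => 'I_(d e)) j)).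
have lead_b e j : lead e (b e j) = (X e)`_j.
  by case: (Hbb (Tagged (fun e => 'I_(d e)) j)).
have notin e j := vbasis_notin_span_others (L := L e) (W := W e) j.
have sz_b e j : sz (b e j) = e.+1.
  have le_b : (sz (b e j) <= e.+1)%N by case: (Hbb (Tagged (fun e => 'I_(d e)) j)).
  apply/eqP; rewrite eqn_leq le_b ltnNge; apply/negP => /(szP HC) b_e.
  have/negP := notin e j; apply; rewrite -/(X e) -lead_b.
  suff -> : lead e (b e j) = 0 by exact: mem0v.
  by apply/ffunP => z; rewrite !ffunE b_e ?size_tuple.
pose B : set R := range bb.
have Bb e j : B (b e j) by exists (Tagged (fun e => 'I_(d e)) j).
have BP y : B y -> exists e j, y = b e j by move=> [[e j] _ <-]; exists e, j.
have BJ : (B `<=` J)%classic by move=> y /BP[e [j ->]].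
exists B; split; last first.
  exact/(sub_countable (card_image_le _ _))/countableP.
apply/(left_ideal_basisP _ idJ); split=> //.
  suff H N u : (sz u <= N)%N -> J u -> lspan B u by move=> u; exact: (H (sz u)).
  have [S0 SD SM] := lspan_ideal B.
  elim: N u => [|e IH] u.
    by rewrite leqn0 -leqn0 leqNgt (sz_gt0 HC) negbK => /eqP->.
  move=> le_u Ju.
  have : lead e u \in L e by apply/HL; exists u.
  have WL : (W e <= L e)%VS.
    by apply/subvP => f /HW[g [/low_sub Jg ge <-]]; apply/HL; exists g.
  rewrite -{1}(addv_diff_cap (L e) (W e)) (capv_idPr WL) => /memv_addP[x Lx [w]].
  case/HW=> g [Gg ge <-] def_u.
  have {}Sg : lspan B g by apply: Gg => [|s Js se]; [exact: lspan_ideal | exact: IH].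
  have /choice[a Ha] := fun j => constant_with_value (coord (X e) j x).
  pose y := \sum_j a j * b e j.
  have Sy : lspan B y.
    by apply: left_ideal_sum => [|j _]; [exact: lspan_ideal | apply/SM/lspan_sub].
  have Jy : J y by apply: left_ideal_sum => // j _; exact: JM.
  have lead_ab j : (sz (a j * b e j) <= e.+1)%N /\
      lead e (a j * b e j) = coord (X e) j x *: (X e)`_j.
    have [a1 <-] := Ha j; rewrite -lead_b; apply: lead_const => //.
    by rewrite sz_b.
  have lead_y : lead e y = x.
    rewrite lead_sum [RHS](coord_vbasis Lx); apply: eq_bigr => j _.
    by case: (lead_ab j).
  have -> : u = (u - (y + g)) + (y + g) by rewrite subrK.
  have Jg := low_sub _ _ Gg.
  apply: (SD) => //; last exact: SD.
  apply: IH; last by apply: (JD) => //; apply: JN; exact: JD.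
  apply: lead_eq0; last by rewrite leadB leadD lead_y def_u subrr.
  apply/(szP HC)/(below_sub HC); first exact/(szP HC).
  apply/(below_add HC); last exact/(szP HC).
  by apply/(below_sum HC) => j _; apply/(szP HC); case: (lead_ab j).
apply: lfree_of_leading => [y /BP[e [j ->]]|p s v i inj_s Bs vi0 le_v].
  by rewrite -(sz_gt0 HC) sz_b.
have [e [j def_i]] := BP _ (Bs i).
rewrite def_i sz_b /= => lt_i; move: le_v; rewrite def_i sz_b => le_v.
have/negP := notin e j; apply; rewrite -/(X e) -lead_b.
have -> : lead e (b e j) = lead e (\sum_r v r * s r).
  apply/eqP; rewrite -subr_eq0 -leadB; apply/eqP/ffunP => z.
  by rewrite !ffunE lt_i ?size_tuple.
rewrite lead_sum; apply: memv_suml => r _.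
have [->|nz_v] := eqVneq (v r) 0; first by rewrite mul0r lead0 mem0v.
have le_r := le_v r nz_v; have [e' [j' def_r]] := BP _ (Bs r).
have [sr|sr] := leqP (sz (s r)) e.
  apply: (subvP (addvSl _ _)); apply/HW; exists (v r * s r); split=> //.
    by have [_ _] := low_ideal_ideal J e; apply=> K idK; apply => //; exact: BJ.
  by apply/(szP HC)/(below_mul (HC := HC)); right; right.
apply: (subvP (addvSr _ _)).
have v1 : (sz (v r) <= 1)%N by lia.
have s1 : (sz (s r) <= e.+1)%N by move: nz_v; rewrite -(sz_gt0 HC); lia.
have [_ ->] := lead_const v1 s1; apply: memvZ.
have ee : e' = e by move: s1 sr; rewrite def_r sz_b; lia.
move: j' def_r; rewrite ee => j' def_r; rewrite def_r lead_b.
have ne : j' != j.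
  apply: contra_neq nz_v => jj; rewrite -vi0; congr v; apply: inj_s.
  by rewrite def_r def_i jj.
by apply: (subvP (sumv_sup j' _ (subvv _))) => //; exact: memv_line.
Qed.

(** For the rank, any basis is covered by the finite supports of the expansions of
the elements of any other basis.  As one basis is countable, all are, so that two
infinite bases are equipotent; and a basis is finite as soon as another one is,
which leaves [invariant_rank]. *)
Theorem leading_left_fir : left_fir R.
Proof.
move=> J idJ; have [B0 [basB0 cntB0]] := exists_basis idJ.
split; first by exists B0.
have cover B B' : left_ideal_basis J B -> left_ideal_basis J B' ->
    exists F : R -> {fset R}, (B `<=` \bigcup_(b in B') [set` F b])%classic.
  move=> /(left_ideal_basisP _ idJ)[BJ spanB freeB].
  move=> /(left_ideal_basisP _ idJ)[BJ' spanB' freeB'].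
  by apply: lfree_cover => // [b /BJ/spanB'|b /BJ'/spanB].
have cntB B : left_ideal_basis J B -> countable B.
  move=> basB; have [F BF] := cover _ _ basB basB0.
  apply: (sub_countable (subset_card_le BF)).
  by apply: bigcup_countable => // b _; exact: countable_fset.
have finB B B' : left_ideal_basis J B -> left_ideal_basis J B' ->
    finite_set B' -> finite_set B.
  move=> basB basB' finB'; have [F BF] := cover _ _ basB basB'.
  by apply: (sub_finite_set BF); apply: bigcup_finite.
move=> B B' basB basB'; case: (pselect (finite_set B)) => fB.
  have fB' := finB _ _ basB' basB fB.
  have [p [s [Bp Js gen_s free_s]]] := finite_basis idJ basB fB.
  have [q [t [Bq Jt gen_t free_t]]] := finite_basis idJ basB' fB'.
  have pq := invariant_rank idJ Js Jt gen_s gen_t free_s free_t.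
  by rewrite (card_eqr Bq) -pq.
have fB' : infinite_set B' by move=> fB'; apply: fB; exact: finB fB'.
by rewrite (card_eqr (eq_card_nat (cntB _ basB') fB')); apply: eq_card_nat => //; exact: cntB.
Qed.

End FreeIdeals.

(** The right-handed statements follow from the left-handed ones by reading words
backwards; the commutativity of [Q] is used here. *)
Lemma leading_calculus_converse (Q : fieldType) (I : finType) (R : nzRingType)
    (C : R -> seq I -> Q) : leading_calculus C ->
  @leading_calculus Q I R^c (fun u w => C u (rev w)).
Proof.
move=> HC; have belowE N u : @degree_below Q I R^c (fun u w => C u (rev w)) N u <->
    degree_below C N u.
  by split=> H w Nw; [rewrite -[w]revK|]; apply: H; rewrite size_rev.
split=> [u v w|u|u|N f|a b u v].
- exact: (lc_sub HC).
- by have [N /asboolP Nu] := lc_bound HC u; exists N; apply/asboolP/belowE.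
- by move/belowE/(lc_inj HC).
- have [u [uN Eu]] := lc_lift HC N (fun w => f (rev w)).
  exists u; split; first exact/belowE.
  by move=> w sw; rewrite Eu ?size_rev // revK.
move=> /belowE ua /belowE vb; have [uv Euv] := lc_mul HC vb ua.
split=> [|z size_z]; first by apply/belowE; rewrite addnC.
rewrite [LHS]Euv ?size_rev 1?addnC // mulrC.
by rewrite rev_take rev_drop size_z addKn.
Qed.

Lemma leading_weak_algorithm_fir (Q : fieldType) (I : finType) (R : nzRingType)
    (C : R -> seq I -> Q) (HC : leading_calculus C) :
  weak_algorithm (edeg HC) /\ free_ideal_ring R.
Proof.
have HC' := leading_calculus_converse HC.
have eq_sz (u : R) : sz HC' u = sz HC u.
  have belowE N : degree_below (R := R^c) (fun u w => C u (rev w)) N u <->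
      degree_below C N u.
    by split=> H w Nw; [rewrite -[w]revK|]; apply: H; rewrite size_rev.
  apply/eqP; rewrite eqn_leq; apply/andP; split; apply/szP/belowE.
    exact: sz_below.
  exact: (sz_below (HC := HC')).
have eq_deg : edeg HC' = edeg HC by apply/funext => u; rewrite /edeg eq_sz.
split; split; [exact: leading_weak_algorithm | | exact: leading_left_fir HC |
  exact: leading_left_fir HC'].
by rewrite -eq_deg; exact: leading_weak_algorithm.
Qed.

(** * Derivations of polynomial rings and of fraction fields *)

Section LinearMaps.
Variables (k : fieldType) (V W : lmodType k) (D : V -> W).
Hypothesis linD : linear D.

Lemma linear_map0 : D 0 = 0.
Proof. by have := linD (-1) 0 0; rewrite scaler0 addr0 scaleN1r addNr. Qed.

Lemma linear_mapD u v : D (u + v) = D u + D v.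
Proof. by have := linD 1 u v; rewrite !scale1r. Qed.

Lemma linear_mapN u : D (- u) = - D u.
Proof. by have := linD (-1) u 0; rewrite linear_map0 !addr0 !scaleN1r. Qed.

End LinearMaps.

Section LinearExtension.
Variables (k : fieldType) (K : choiceType).

Definition lext (V : lmodType k) (F : K -> V) (c : malg K k) : V :=
  \sum_(i <- msupp c) mcoeff i c *: F i.

Lemma lextEw (V : lmodType k) (F : K -> V) (d : {fset K}) c :
  {subset msupp c <= d} -> lext F c = \sum_(i <- d) mcoeff i c *: F i.
Proof.
move=> /fsubsetP sub_cd; rewrite [LHS](big_fset_incl _ sub_cd) // => i _.
by move/mcoeff_outdom->; rewrite scale0r.
Qed.

Lemma lext_linear (V : lmodType k) (F : K -> V) : linear (lext F).
Proof.
move=> a c c'; pose d := (msupp (a *: c + c') `|` msupp c `|` msupp c')%fset.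
have [d1 d2 d3] : [/\ {subset msupp (a *: c + c') <= d}, {subset msupp c <= d}
    & {subset msupp c' <= d}].
  by split=> i ic; rewrite !in_fsetU ic ?orbT.
rewrite (lextEw _ d1) (lextEw _ d2) (lextEw _ d3) scaler_sumr -big_split /=.
by apply: eq_bigr => i _; rewrite mcoeffD mcoeffZ scalerDl scalerA.
Qed.

Lemma lextU (V : lmodType k) (F : K -> V) i : lext F (mkmalgU i 1) = F i.
Proof.
rewrite (lextEw F (d := [fset i]%fset)) => [|j]; last exact: (fsubsetP msuppU_le).
by rewrite big_seq_fset1 mcoeffUU scale1r.
Qed.

Lemma malg_ind_linear (P : malg K k -> Prop) :
  P 0 -> (forall a c c', P c -> P c' -> P (a *: c + c')) ->
  (forall i, P (mkmalgU i 1)) -> forall c, P c.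
Proof.
move=> P0 Plin PU c; rewrite (monalgE c).
elim/big_ind: _ => // [x y Px Py|i _]; first by rewrite -[x]scale1r; exact: Plin.
have -> : mkmalgU i (mcoeff i c) = mcoeff i c *: mkmalgU i 1.
  by apply/malgP => j; rewrite mcoeffZ !mcoeffU; case: eqP; rewrite ?mulr1 ?mulr0.
by rewrite -[_ *: _]addr0; exact: Plin.
Qed.

Lemma malg_ext (V : lmodType k) (F G : malg K k -> V) :
  linear F -> linear G -> (forall i, F (mkmalgU i 1) = G (mkmalgU i 1)) -> F =1 G.
Proof.
move=> linF linG eqFG; apply: malg_ind_linear => // [|a c c' Ec Ec'].
  by rewrite (linear_map0 linF) (linear_map0 linG).
by rewrite (linF a c c') (linG a c c') Ec Ec'.
Qed.

Lemma linear_basis_extend (g V : lmodType k) (e : K -> g) (F : K -> V) :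
  linear_basis e ->
  exists L : {linear g -> V}, forall i, L (e i) = F i.
Proof.
move=> bas; have /choice[c Hc] := bas.
have cP v : v = lext e (c v) by case: (Hc v).
have cU v c' : v = lext e c' -> c v = c' by case: (Hc v) => _; apply.
have linL : linear (fun v => lext F (c v)).
  move=> a u v; rewrite -lext_linear; congr lext; apply: cU.
  by rewrite lext_linear -!cP.
pose A := GRing.isLinear.Build _ _ _ _ _ linL.
pose L : {linear g -> V} := HB.pack (fun v => lext F (c v)) A.
exists L => i /=; rewrite /L /=; rewrite (cU _ (mkmalgU i 1)) ?lextU //.
Qed.

Lemma linear_basis_ind (g : lmodType k) (e : K -> g) (P : g -> Prop) :
  linear_basis e -> P 0 -> (forall a u v, P u -> P v -> P (a *: u + v)) ->
  (forall i, P (e i)) -> forall v, P v.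
Proof.
move=> bas P0 Plin Pe v; have [c [-> _]] := bas v.
elim/big_ind: _ => // [x y Px Py|i _]; first by rewrite -[x]scale1r; exact: Plin.
by rewrite -[_ *: _]addr0; exact: Plin.
Qed.

End LinearExtension.

Section FractionDerivations.
Variables (k : fieldType) (P : comAlgType k) (Q : fieldAlgType k).
Variables (iota : {lrmorphism P -> Q}) (E : algType k) (mm : {lrmorphism Q -> E}).

(** [E] is regarded as a module over [Q] through left multiplication by [mm], and
[P'] acts on it through [f]. *)
Definition derivation_on (P' : comAlgType k) (f : P' -> Q) (D : P' -> E) : Prop :=
  linear D /\ forall a b, D (a * b) = mm (f a) * D b + mm (f b) * D a.

Lemma mm_cancel q X Y : q != 0 -> mm q * X = mm q * Y -> X = Y.
Proof.
move=> nz_q eqXY; rewrite -[X]mul1r -[Y]mul1r -(rmorph1 mm) -(mulVf nz_q) rmorphM.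
by rewrite -!mulrA eqXY.
Qed.

(** The value at [q = a / b] is the solution [X] of [b X = d a - q d b], which does not
depend on the chosen fraction because [d] satisfies the Leibniz rule. *)
Lemma derivation_frac (d : P -> E) : field_of_fractions iota ->
  derivation_on iota d ->
  exists D : Q -> E, derivation_on id D /\ forall f, D (iota f) = d f.
Proof.
move=> [inj_iota fracQ] [lin_d leib_d].
have d1 : d 1 = 0.
  have := leib_d 1 1; rewrite mulr1 rmorph1 rmorph1 !mul1r => /eqP.
  by rewrite -subr_eq0 opprD addNKr oppr_eq0 => /eqP.
have key q : exists X, forall a b, iota b != 0 -> q * iota b = iota a ->
    mm (iota b) * X = d a - mm q * d b.
  have [a0 [b0 [nz_b0 def_q]]] := fracQ q.
  have def_a0 : q * iota b0 = iota a0 by rewrite def_q divfK.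
  exists (mm (iota b0)^-1 * (d a0 - mm q * d b0)) => a b nz_b def_a.
  apply: (mm_cancel nz_b0).
  rewrite !mulrA -!(rmorphM mm) mulrAC mulfV // mul1r !mulrBr !mulrA -!(rmorphM mm).
  have : d (a * b0) = d (a0 * b).
    by congr d; apply: inj_iota; rewrite !rmorphM /= -def_a -def_a0 mulrAC.
  rewrite !leib_d -def_a -def_a0 => E1.
  rewrite [iota b * q]mulrC [iota b0 * q]mulrC.
  apply/eqP; rewrite subr_eq addrAC eq_sym subr_eq eq_sym [eqbLHS]addrC -E1 addrC.
  by rewrite addrC.
have /choice[D HD] := key.
have common p q : exists a a' b,
    [/\ iota b != 0, p * iota b = iota a & q * iota b = iota a'].
  have [a [b [nz_b ->]]] := fracQ p; have [a' [b' [nz_b' ->]]] := fracQ q.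
  exists (a * b'), (a' * b), (b * b'); rewrite !rmorphM mulf_neq0 //; split=> //.
    by rewrite mulrA divfK.
  by rewrite [iota b * _]mulrC mulrA divfK.
exists D; split; [split|].
- move=> c p q; have [a [a' [b [nz_b def_a def_a']]]] := common p q.
  apply: (mm_cancel nz_b); rewrite (HD _ (c *: a + a') b) //; last first.
    by rewrite linearP /= -def_a -def_a' mulrDl scalerAl.
  rewrite mulrDr -scalerAr (HD p a b) // (HD q a' b) // lin_d linearP mulrDl.
  by rewrite scalerBr opprD scalerAl addrACA.
- move=> p q; have [a [a' [b [nz_b def_a def_a']]]] := common p q.
  have nz_bb : iota (b * b) != 0 by rewrite rmorphM mulf_neq0.
  apply: (mm_cancel nz_bb); rewrite (HD _ (a * a') (b * b)) //; last first.
    by rewrite !rmorphM /= -def_a -def_a' mulrACA.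
  rewrite !leib_d -def_a -def_a' [RHS]mulrDr /=.
  have E1 : mm (iota (b * b)) * (mm p * D q) = mm (p * iota b) * (mm (iota b) * D q).
    by rewrite !mulrA -!(rmorphM mm) (rmorphM iota) /= -[p * _ * _]mulrA [_ * p]mulrC.
  have E2 : mm (iota (b * b)) * (mm q * D p) = mm (q * iota b) * (mm (iota b) * D p).
    by rewrite !mulrA -!(rmorphM mm) (rmorphM iota) /= -[q * _ * _]mulrA [_ * q]mulrC.
  have E3 : mm (p * iota b) * (mm q * d b) = mm (p * q) * (mm (iota b) * d b).
    by rewrite !mulrA -!(rmorphM mm) mulrAC.
  have E4 : mm (q * iota b) * (mm p * d b) = mm (p * q) * (mm (iota b) * d b).
    by rewrite !mulrA -!(rmorphM mm) mulrAC [q * p]mulrC.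
  rewrite E1 E2 (HD p a b) // (HD q a' b) // !mulrBr E3 E4 [in LHS]mulrDr.
  by rewrite opprD addrACA.
- move=> f; have := HD (iota f) f 1; rewrite rmorph1 oner_neq0 mulr1 d1 mulr0 subr0.
  by rewrite rmorph1 mul1r; apply.
Qed.

End FractionDerivations.

Section PolynomialDerivations.
Variables (k : fieldType) (I : choiceType) (Q : fieldAlgType k).
Local Notation P := (malg (cmonom I) k).
Variables (iota : {lrmorphism P -> Q}) (E : algType k) (mm : {lrmorphism Q -> E}).
Variable (F : I -> E).
Hypothesis inj_iota : injective iota.

Let mon (m : cmonom I) : P := mkmalgU m 1.

(** The logarithmic derivative of a monomial: it turns products into sums, so that
multiplying it back by the monomial gives the Leibniz rule.  The variables can be
inverted because the values live over the field [Q]. *)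
Definition dlog (m : cmonom I) : E :=
  \sum_(i <- finsupp m) (mm (iota (pvar k i))^-1 * F i) *+ m i.

Lemma dlogM m m' : dlog (mmul m m') = dlog m + dlog m'.
Proof.
have dlogEw (d : {fset I}) (m0 : cmonom I) : {subset finsupp m0 <= d} ->
    dlog m0 = \sum_(i <- d) (mm (iota (pvar k i))^-1 * F i) *+ m0 i.
  move=> /fsubsetP sub; rewrite [LHS](big_fset_incl _ sub) // => i _.
  by rewrite -cmE_eq0 => /eqP->.
pose d := (finsupp m `|` finsupp m')%fset.
rewrite (dlogEw d (mmul m m')) ?(dlogEw d m) ?(dlogEw d m') => [|i im|i im|i].
- by rewrite -big_split; apply: eq_bigr => i _; rewrite cmM mulrnDr.
- by rewrite in_fsetU im orbT.
- by rewrite in_fsetU im.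
- by rewrite mdomD.
Qed.

Lemma iota_pvar_neq0 i : iota (pvar k i) != 0.
Proof.
rewrite -(rmorph0 iota) (inj_eq inj_iota).
by rewrite /pvar monalgU_eq0 oner_eq0.
Qed.

Lemma monM m m' : mon m * mon m' = mon (mmul m m').
Proof. by rewrite malgM_def fgmulUU mulr1. Qed.

Lemma derivation_poly :
  exists d : P -> E, derivation_on mm iota d /\ forall i, d (pvar k i) = F i.
Proof.
exists (lext (fun m => mm (iota (mon m)) * dlog m)); split; last first.
  move=> i; rewrite lextU /dlog mdomU big_seq_fset1 cmUU mulr1n mulrA -rmorphM.
  by rewrite mulfV ?iota_pvar_neq0 // rmorph1 mul1r.
have := @lext_linear k (cmonom I) E (fun m => mm (iota (mon m)) * dlog m).
have : forall m, lext (fun m => mm (iota (mon m)) * dlog m) (mon m) =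
    mm (iota (mon m)) * dlog m by move=> m; exact: lextU.
move: (lext _) => d dU lin.
have linm : linear (fun f => mm (iota f)).
  by move=> a u v; rewrite (linearP iota) (linearP mm).
have leib_lin g : linear (fun f => mm (iota f) * d g + mm (iota g) * d f).
  move=> a u v; rewrite linm (lin a u v) mulrDl mulrDr scalerDr.
  by rewrite -!scalerAl -!scalerAr addrACA.
split=> // f g; move: f; apply: malg_ext (leib_lin g) _ => [a u v|m].
  by rewrite mulrDl -scalerAl; exact: lin.
move: g; apply: malg_ext => [a u v|a u v|m'].
- by rewrite mulrDr -scalerAr; exact: lin.
- by rewrite linm (lin a u v) mulrDl mulrDr scalerDr -!scalerAl -!scalerAr addrACA.
have mmC p q X : mm p * (mm q * X) = mm (q * p) * X.
  by rewrite mulrA -(rmorphM mm) mulrC.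
have E1 : d (mon m * mon m') =
    mm (iota (mon m) * iota (mon m')) * (dlog m + dlog m').
  by rewrite monM dU dlogM -monM (rmorphM iota).
have F1 : mm (iota (mon m)) * d (mon m') =
    mm (iota (mon m) * iota (mon m')) * dlog m'.
  by rewrite dU mulrA -(rmorphM mm).
have F2 : mm (iota (mon m')) * d (mon m) =
    mm (iota (mon m) * iota (mon m')) * dlog m.
  rewrite dU; exact: mmC.
apply: (etrans E1); rewrite mulrDr addrC.
exact: (esym (congr2 +%R F1 F2)).
Qed.

End PolynomialDerivations.

(** * Lie brackets and commutators *)

Section LieIdentities.
Variables (k : fieldType) (L : lmodType k) (br : L -> L -> L).
Hypothesis Hbr : lie_bracket br.

Lemma lieDl y z t : br (y + z) t = br y t + br z t.
Proof. by have := lie_linearl Hbr t 1 y z; rewrite !scale1r. Qed.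

Lemma lieDr y z t : br t (y + z) = br t y + br t z.
Proof. by have := lie_linearr Hbr t 1 y z; rewrite !scale1r. Qed.

Lemma lie0l y : br 0 y = 0.
Proof. by apply: (addrI (br 0 y)); rewrite -lieDl !addr0. Qed.

Lemma lie0r y : br y 0 = 0.
Proof. by apply: (addrI (br y 0)); rewrite -lieDr !addr0. Qed.

Lemma lieZl a y z : br (a *: y) z = a *: br y z.
Proof. by have := lie_linearl Hbr z a y 0; rewrite !addr0 lie0l addr0. Qed.

Lemma lieZr a y z : br z (a *: y) = a *: br z y.
Proof. by have := lie_linearr Hbr z a y 0; rewrite !addr0 lie0r addr0. Qed.

Lemma lieC y z : br y z = - br z y.
Proof.
apply/eqP; rewrite -addr_eq0; have := lie_alt Hbr (y + z).
by rewrite lieDl !lieDr !(lie_alt Hbr) addr0 add0r => ->.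
Qed.

Lemma lieNr y z : br z (- y) = - br z y.
Proof. by rewrite -scaleN1r lieZr scaleN1r. Qed.

Lemma lie_derivation y z t : br (br y z) t = br y (br z t) - br z (br y t).
Proof.
apply/eqP; rewrite -subr_eq0; have := lie_jacobi Hbr y z t.
rewrite [br (br y z) t]lieC [br t y]lieC lieNr => /eqP; rewrite -oppr_eq0.
by rewrite !opprD !opprK addrC.
Qed.

End LieIdentities.

Section Commutator.
Variables (k : fieldType) (A : algType k).

Definition commutator (a b : A) : A := a * b - b * a.

Lemma commutator_lie : lie_bracket (commutator : (A : lmodType k) -> _ -> _).
Proof.
split=> [z a u v|z a u v|y|y z t]; rewrite /commutator.
- rewrite mulrDl mulrDr -scalerAl -scalerAr scalerBr opprD addrACA //.
- rewrite mulrDl mulrDr -scalerAl -scalerAr scalerBr opprD addrACA //.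
- by rewrite subrr.
rewrite !mulrBr !mulrBl !mulrA.
have E (V : zmodType) (a b c d : V) : a - b - (c - d) = (a + d) - (b + c).
  by rewrite opprB addrACA -opprD.
rewrite !E [y * t * z + _]addrC [t * y * z + _]addrC [t * z * y + _]addrC.
by rewrite !subrKA subrr.
Qed.

Lemma commutatorMl (a b c : A) :
  commutator (b * c) a = commutator b a * c + b * commutator c a.
Proof. by rewrite /commutator mulrBl mulrBr !mulrA [RHS]addrC subrKA. Qed.

End Commutator.

(** * The free Poisson field *)

Section FreePoissonField.
Variables (k : fieldType) (n : nat) (Q : fieldAlgType k) (br : Q -> Q -> Q).
Variables (x : 'I_n -> Q) (g : lmodType k) (brg : g -> g -> g) (xg : 'I_n -> g).
Variables (I : choiceType) (e : I -> g) (v : 'I_n -> I).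
Local Notation P := (malg (cmonom I) k).
Variables (brP : P -> P -> P) (iota : {lrmorphism P -> Q}).
Hypothesis free_g : free_lie_algebra brg xg.
Hypothesis basis_e : linear_basis e.
Hypothesis multihomogeneous_e : forall i, multihomogeneous brg xg (e i).
Hypothesis e_v : forall i, e (v i) = xg i.
Hypothesis bracket_P : free_poisson_bracket brg e brP.
Hypothesis frac_Q : field_of_fractions iota.
Hypothesis poisson_Q : poisson_bracket br.
Hypothesis br_iota : forall a b, br (iota a) (iota b) = iota (brP a b).
Hypothesis x_v : forall i, x i = iota (pvar k (v i)).

(** Every [e i] is a combination of Lie monomials in the generators, hence so is every
element of [g]. *)
Lemma lie_generated_ind (C : g -> Prop) :
  C 0 -> (forall a u w, C u -> C w -> C (a *: u + w)) ->
  (forall u w, C u -> C w -> C (brg u w)) -> (forall i, C (xg i)) ->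
  forall u, C u.
Proof.
move=> C0 Clin Cbr Cx; apply: (linear_basis_ind basis_e) => // i.
have [d [c [Hc ->]]] := multihomogeneous_e i.
rewrite big_seq; elim/big_ind: _ => // [y z Cy Cz|u /Hc mon_u].
  by rewrite -[y]scale1r; exact: Clin.
rewrite -[_ *: _]addr0; apply: Clin => //.
by elim: mon_u => // *; exact: Cbr.
Qed.

Lemma fraction_field_ind (C : Q -> Prop) : C 1 ->
  (forall a p q, C p -> C q -> C (a *: p + q)) ->
  (forall p q, C p -> C q -> C (p * q)) ->
  (forall a b q, C a -> C b -> b != 0 -> q * b = a -> C q) ->
  (forall i, C (iota (pvar k i))) -> forall q, C q.
Proof.
move=> C1 Clin Cmul Cdiv Cvar q.
have C0 : C 0 by have := Clin (-1) 1 1 C1 C1; rewrite scaleN1r addNr.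
suff CP f : C (iota f).
  have [a [b [nz_b ->]]] := frac_Q.2 q.
  by apply: (Cdiv (iota a) (iota b)) => //; rewrite divfK.
elim/malg_ind_linear: f => [|a f f' Cf Cf'|m].
- by rewrite rmorph0.
- by rewrite (linearP iota); exact: Clin.
have [d] := ubnP (mdeg m); elim: d m => // d IH m; rewrite ltnS => le_m.
have [|nz_m] := eqVneq (mdeg m) 0%N.
  by move/eqP; rewrite mdeg_eq0 => /eqP->; rewrite rmorph1.
have [i im] : exists i, i \in finsupp m.
  apply: contrapT => H; case/eqP: nz_m; rewrite mdegE big_seq big1 // => i im.
  by case: H; exists i.
pose m' := divcm m (ucm i).
have def_m : m = mmul (ucm i) m'.
  apply/eqP/cmP => j; rewrite cmM cmU divcmE cmU.
  case: (eqVneq i j) => [<-|_]; last by rewrite subn0.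
  by rewrite subnKC // lt0n cmE_neq0.
have -> : mkmalgU m (1 : k) = pvar k i * mkmalgU m' 1.
  by rewrite /pvar malgM_def fgmulUU mulr1 -def_m.
rewrite (rmorphM iota); apply: Cmul; [exact: Cvar | apply: IH].
by move: le_m; rewrite {1}def_m mdegM mdegU add1n.
Qed.

Lemma derivation_ext (E : algType k) (mm : {lrmorphism Q -> E}) (F G : Q -> E) :
  derivation_on mm id F -> derivation_on mm id G ->
  (forall i, F (iota (pvar k i)) = G (iota (pvar k i))) -> F =1 G.
Proof.
move=> [linF leibF] [linG leibG] eqFG.
have d1 D : (forall a b, D (a * b) = mm a * D b + mm b * D a) -> D 1 = 0.
  move=> /(_ 1 1); rewrite mulr1 rmorph1 !mul1r => /eqP.
  by rewrite -subr_eq0 opprD addNKr oppr_eq0 => /eqP.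
apply: fraction_field_ind => // [|a p q Fp Fq|p q Fp Fq|a b q Fa Fb nz_b def_a].
- by rewrite (d1 _ leibF) (d1 _ leibG).
- by rewrite (linF a p q) (linG a p q) Fp Fq.
- by rewrite leibF leibG Fp Fq.
apply: (mm_cancel (mm := mm) nz_b).
move: Fa; rewrite -def_a leibF leibG Fb => /addrI; exact.
Qed.

Let lie_Q := poisson_lie poisson_Q.

(** [g] is identified with the span of the variables; that this respects brackets is
the defining property of the free Poisson bracket. *)
Lemma lie_embedding : exists lin : {linear g -> Q},
  [/\ forall i, lin (e i) = iota (pvar k i),
      forall u w, lin (brg u w) = br (lin u) (lin w) &
      forall i, lin (xg i) = x i].
Proof.
have [lin lin_e] := linear_basis_extend (fun i => iota (pvar k i)) basis_e.
have lie_g := free_g.1.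
exists lin; split=> // [u w|i]; last by rewrite -e_v lin_e x_v.
move: u; apply: (linear_basis_ind basis_e) => [|a u u' Eu Eu'|i].
- by rewrite (lie0l lie_g) !linear0 (lie0l lie_Q).
- rewrite (lieDl lie_g) (lieZl lie_g) !linearP Eu Eu'.
  by rewrite (lieDl lie_Q) (lieZl lie_Q).
move: w; apply: (linear_basis_ind basis_e) => [|a u u' Eu Eu'|j].
- by rewrite (lie0r lie_g) !linear0 (lie0r lie_Q).
- rewrite (lieDr lie_g) (lieZr lie_g) !linearP Eu Eu'.
  by rewrite (lieDr lie_Q) (lieZr lie_Q).
have [c [def_c _]] := basis_e (brg (e i) (e j)).
rewrite !lin_e br_iota (bracket_P.2 _ _ _ def_c) def_c !linear_sum.
by apply: eq_bigr => l _; rewrite !linearZ /= lin_e.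
Qed.

Lemma br_mull (a b c : Q) : br (b * c) a = b * br c a + c * br b a.
Proof.
rewrite (lieC lie_Q) (poisson_leibniz poisson_Q) (lieC lie_Q a b) (lieC lie_Q a c).
by rewrite mulNr mulrN opprD !opprK addrC [_ * c]mulrC.
Qed.

Section Representation.
Variables (E : algType k) (mm : {lrmorphism Q -> E}) (H : 'I_n -> E).
Hypothesis H_commutes : forall i a, commutator (H i) (mm a) = mm (br (x i) a).

Lemma mm_comm a b : commutator (mm a) (mm b) = 0.
Proof. by rewrite /commutator -!(rmorphM mm) mulrC subrr. Qed.

(** Operators [H i] that satisfy the commutation relations of the [h_{x_i}] extend to
a representation of the whole enveloping algebra.  By freeness, [g] acts through a
Lie morphism [rho]; let [h] be the derivation with [h (e i) = rho (e i)].  The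
commutator of [h a] with [mm b] and [mm (br a b)] are derivations in [a] that
agree on the variables.  Once this is known, the defect
[commutator (h a) (h b) - h (br a b)] becomes a derivation in [a]; it is
antisymmetric and vanishes on pairs of variables since [rho] respects brackets,
so it is zero. *)
Lemma enveloping_derivation : exists h : Q -> E,
  [/\ derivation_on mm id h, forall i, h (x i) = H i,
      forall a b, commutator (h a) (mm b) = mm (br a b) &
      forall a b, h (br a b) = commutator (h a) (h b)].
Proof.
have lie_E := commutator_lie E.
have [rho [rho_hom rho_x _]] := free_g.2 E _ lie_E H.
have [lin [lin_e lin_hom lin_x]] := lie_embedding.
have rho_mm u b : commutator (rho u) (mm b) = mm (br (lin u) b).
  move: u b; apply: lie_generated_ind => [b|a u w Eu Ew b|u w Eu Ew b|i b].
  - by rewrite !linear0 (lie0l lie_E) (lie0l lie_Q) linear0.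
  - rewrite (linearP rho) (linearP lin) (lieDl lie_E) (lieZl lie_E) Eu Ew.
    by rewrite (lieDl lie_Q) (lieZl lie_Q) (linearP mm).
  - rewrite rho_hom lin_hom (lie_derivation lie_E) (lie_derivation lie_Q).
    by rewrite Eu Ew Eu Ew (linearB mm).
  - by rewrite rho_x lin_x.
have [d [der_d d_e]] := derivation_poly mm (fun i => rho (e i)) frac_Q.1.
have [h [der_h h_iota]] := derivation_frac frac_Q der_d.
have [lin_h leib_h] := der_h.
have h_lin u : h (lin u) = rho u.
  move: u; apply: (linear_basis_ind basis_e) => [|a u w Eu Ew|i].
  - by rewrite !linear0 (linear_map0 lin_h).
  - by rewrite (linearP lin) (linearP rho) (lin_h a) Eu Ew.
  - by rewrite lin_e h_iota d_e.
have h_mm a b : commutator (h a) (mm b) = mm (br a b).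
  move: a; apply: (derivation_ext (mm := mm)).
  - split=> [c p q|p q].
      by rewrite (lin_h c p q) (lieDl lie_E) (lieZl lie_E).
    by rewrite leib_h (lieDl lie_E) !commutatorMl !mm_comm !mul0r !add0r.
  - split=> [c p q|p q]; first by rewrite (lieDl lie_Q) (lieZl lie_Q) (linearP mm).
    by rewrite br_mull (linearD mm) !(rmorphM mm).
  by move=> i; rewrite -lin_e h_lin rho_mm.
pose T b a := commutator (h a) (h b) - h (br a b).
have mm_h a b : commutator (mm a) (h b) = mm (br a b).
  by rewrite (lieC lie_E) h_mm (lieC lie_Q) (linearN mm) opprK.
have der_T b : derivation_on mm id (T b).
  rewrite /T; split=> [c p q|p q].
    rewrite (lin_h c p q) (lieDl lie_E) (lieZl lie_E) (lieDl lie_Q) (lieZl lie_Q).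
    by rewrite (lin_h c) opprD addrACA -scalerBr.
  rewrite br_mull (linear_mapD lin_h) !leib_h (lieDl lie_E) !commutatorMl.
  have E0 (V : zmodType) (a1 b1 c1 d1 f0 g0 : V) :
      a1 + c1 + (b1 + d1) - (f0 + b1 + (g0 + a1)) = c1 - f0 + (d1 - g0).
    rewrite [a1 + c1]addrC [b1 + d1]addrC addrACA [f0 + b1 + _]addrACA [b1 + a1]addrC.
    by rewrite opprD [LHS]addrACA subrr addr0 opprD [LHS]addrACA.
  by rewrite !mm_h !mulrBr E0.
have T0 b : (forall i, T b (iota (pvar k i)) = 0) -> forall a, T b a = 0.
  move=> Tb; apply: (derivation_ext (mm := mm) (G := fun=> 0)) => //.
  by split=> [c p q|p q]; rewrite ?scaler0 ?mulr0 addr0.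
have TC a b : T b a = - T a b.
  rewrite /T (lieC lie_E (h a)) (lieC lie_Q a) (linear_mapN lin_h).
  by rewrite [RHS]opprB opprK addrC.
exists h; split=> //; first by move=> i; rewrite -lin_x h_lin rho_x.
move=> a b; apply/esym/eqP; rewrite -subr_eq0; apply/eqP; rewrite -/(T b a).
apply: (T0) => i; rewrite TC T0 ?oppr0 // => j.
have T_lin p q u w : lin u = p -> lin w = q -> T q p = 0.
  by move=> <- <-; rewrite /T -lin_hom !h_lin rho_hom subrr.
exact: T_lin (lin_e j) (lin_e i).
Qed.

End Representation.
End FreePoissonField.

(** * The universal enveloping algebra *)

Lemma malgU_scalerAr (K : monomType) (k : fieldType) (w : K) (a : k) (u : malg K k) :
  mkmalgU w 1 * (a *: u) = a *: (mkmalgU w 1 * u).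
Proof.
rewrite -!mul_malgC !mulrA; congr (_ * _).
by rewrite !malgM_def !fgmulUU mulr1 mul1r mulm1 mul1m.
Qed.

Section FreeAlgebraMaps.
Variables (k : fieldType) (P : comAlgType k) (E : algType k) (m h : P -> E).

Definition letter (l : P + P) : E := match l with inl a => m a | inr a => h a end.
Definition wordprod (w : fmonom (P + P)%type) : E := \prod_(l <- (w : seq _)) letter l.

Lemma free_algebra_lift : exists psi : env_free P -> E,
  [/\ linear psi, psi 1 = 1, forall f g, psi (f * g) = psi f * psi g,
      forall a, psi (env_m a) = m a & forall a, psi (env_h a) = h a].
Proof.
exists (lext wordprod : env_free P -> E).
have lin : linear (lext wordprod : env_free P -> E) by exact: lext_linear.
have psiU w : lext wordprod (mkmalgU w 1) = wordprod w by exact: lextU.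
split=> //.
- by rewrite -[1]/(mkmalgU _ _) psiU /wordprod fm1 big_nil.
- move: (lext _ : env_free P -> E) lin psiU => psi lin psiU f g.
  move: f; apply: malg_ext => [a u v|a u v|w].
  + by rewrite mulrDl -scalerAl; exact: lin.
  + by rewrite (lin a u v) mulrDl scalerAl.
  move: g; apply: malg_ext => [a u v|a u v|w'].
  + have -> : mkmalgU w 1 * (a *: u + v) = a *: (mkmalgU w 1 * u) + mkmalgU w 1 * v.
      by rewrite mulrDr malgU_scalerAr.
    exact: lin.
  + by rewrite (lin a u v) mulrDr scalerAr.
  have -> : (mkmalgU w 1 * mkmalgU w' 1 : env_free P) = mkmalgU (mmul w w') 1.
    by rewrite malgM_def fgmulUU mulr1.
  by rewrite !psiU /wordprod fmM big_cat.
- by move=> a; rewrite psiU /wordprod fmU big_seq1.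
- by move=> a; rewrite psiU /wordprod fmU big_seq1.
Qed.

End FreeAlgebraMaps.

Section UniversalProperty.
Variables (k : fieldType) (Q : comAlgType k) (br : Q -> Q -> Q).
Variables (U : algType k) (m h : Q -> U).
Hypothesis hU : universal_enveloping br m h.

Lemma env_relations :
  [/\ linear m, linear h, m 1 = 1 & forall a b, m (a * b) = m a * m b] /\
  [/\ forall a b, h (br a b) = h a * h b - h b * h a,
      forall a b, h (a * b) = m b * h a + m a * h b &
      forall a b, m (br a b) = h a * m b - m b * h a].
Proof.
have [phi [phi_m phi_h _ ker_phi]] := hU.
have phiM f g u v : phi f = u -> phi g = v -> phi (f * g) = u * v.
  by move=> <- <-; exact: rmorphM.
have phiD f g u v : phi f = u -> phi g = v -> phi (f + g) = u + v.
  by move=> <- <-; exact: linearD.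
have phiB f g u v : phi f = u -> phi g = v -> phi (f - g) = u - v.
  by move=> <- <-; exact: linearB.
have phiZ c f u : phi f = u -> phi (c *: f) = c *: u.
  by move=> <-; exact: linearZ.
have rel f g u v : env_relation br (f - g) -> phi f = u -> phi g = v -> u = v.
  move=> rel_fg <- <-; apply/eqP; rewrite -subr_eq0 -(phiB f g _ _ erefl erefl).
  apply/eqP/ker_phi; rewrite -[f - g]mul1r -[_ * (f - g)]mulr1; exact: GenIdealM.
split; split.
- move=> c a b; apply: rel (EnvLinM br c a b) (phi_m _) (phiD _ _ _ _ _ (phi_m b)).
  exact: phiZ.
- move=> c a b; apply: rel (EnvLinH br c a b) (phi_h _) (phiD _ _ _ _ _ (phi_h b)).
  exact: phiZ.
- exact: rel (EnvM1 br) (phi_m _) (rmorph1 phi).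
- by move=> a b; apply: rel (EnvMM br a b) (phi_m _) (phiM _ _ _ _ _ _).
- move=> a b; apply: rel (EnvHBr br a b) (phi_h _) (phiB _ _ _ _ _ _).
    exact: phiM (phi_h a) (phi_h b).
  exact: phiM (phi_h b) (phi_h a).
- move=> a b; apply: rel (EnvHM br a b) (phi_h _) (phiD _ _ _ _ _ _).
    exact: phiM (phi_m b) (phi_h a).
  exact: phiM (phi_m a) (phi_h b).
- move=> a b; apply: rel (EnvMBr br a b) (phi_m _) (phiB _ _ _ _ _ _).
    exact: phiM (phi_h a) (phi_m b).
  exact: phiM (phi_m b) (phi_h a).
Qed.

Lemma env_generated (S : U -> Prop) :
  S 1 -> (forall c u v, S u -> S v -> S (c *: u + v)) ->
  (forall u v, S u -> S v -> S (u * v)) ->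
  (forall a, S (m a)) -> (forall a, S (h a)) -> forall u, S u.
Proof.
move=> S1 Slin SM Sm Sh u; have [phi [phi_m phi_h surj_phi _]] := hU.
have [f <-] := surj_phi u.
have S0 : S 0 by have := Slin (-1) 1 1 S1 S1; rewrite scaleN1r addNr.
elim/malg_ind_linear: f => [|a f f' Sf Sf'|w].
- by rewrite linear0.
- by rewrite (linearP phi); exact: Slin.
have [s ->] : exists s : seq (Q + Q)%type, w = FMonom s by exists w; rewrite fmK.
elim: s => [|l s IH].
  have -> : mkmalgU (FMonom [::]) 1 = (1 : env_free Q).
    by rewrite -fmoneE.
  by rewrite rmorph1.
have -> : mkmalgU (FMonom (l :: s)) 1 =
    (mkmalgU (fmu l) 1 * mkmalgU (FMonom s) 1 : env_free Q).
  rewrite malgM_def fgmulUU mulr1; congr mkmalgU.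
  by rewrite fmuE; apply/esym/fmmulE.
rewrite (rmorphM phi); apply: SM; last exact: IH.
case: l => a.
- by have : S (phi (env_m a)) by rewrite phi_m.
- by have : S (phi (env_h a)) by rewrite phi_h.
Qed.

Lemma env_lift (E : algType k) (mE hE : Q -> E) :
  [/\ linear mE, linear hE, mE 1 = 1 & forall a b, mE (a * b) = mE a * mE b] ->
  [/\ forall a b, hE (br a b) = hE a * hE b - hE b * hE a,
      forall a b, hE (a * b) = mE b * hE a + mE a * hE b &
      forall a b, mE (br a b) = hE a * mE b - mE b * hE a] ->
  exists rho : U -> E,
    [/\ linear rho, rho 1 = 1, forall u v, rho (u * v) = rho u * rho v,
        forall a, rho (m a) = mE a & forall a, rho (h a) = hE a].
Proof.
move=> [linm linh m1 mM] [hbr hM mbr].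
have [psi [lin_psi psi1 psiM psi_m psi_h]] := free_algebra_lift mE hE.
have [phi [phi_m phi_h surj_phi ker_phi]] := hU.
have psiM' f g u v : psi f = u -> psi g = v -> psi (f * g) = u * v.
  by move=> <- <-; exact: psiM.
have psiD f g u v : psi f = u -> psi g = v -> psi (f + g) = u + v.
  by move=> <- <-; exact: linear_mapD.
have psiB f g u v : psi f = u -> psi g = v -> psi (f - g) = u - v.
  by move=> <- <-; rewrite (linear_mapD lin_psi) (linear_mapN lin_psi).
have psiZ c f g u v : psi f = u -> psi g = v -> psi (c *: f + g) = c *: u + v.
  by move=> <- <-; exact: lin_psi.
have ker f : generated_ideal (env_relation br) f -> psi f = 0.
  elim=> [|a b _ Ea _ Eb|a r b]; first exact: (linear_map0 lin_psi).
    by rewrite (psiD _ _ _ _ Ea Eb) addr0.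
  move=> rel_r; rewrite !psiM; suff -> : psi r = 0 by rewrite mulr0 mul0r.
  case: rel_r => [c p q|c p q|p q|p q|p q|p q|].
  - by rewrite (psiB _ _ _ _ (psi_m _) (psiZ _ _ _ _ _ (psi_m p) (psi_m q))) linm subrr.
  - by rewrite (psiB _ _ _ _ (psi_h _) (psiZ _ _ _ _ _ (psi_h p) (psi_h q))) linh subrr.
  - by rewrite (psiB _ _ _ _ (psi_m _) (psiM' _ _ _ _ (psi_m p) (psi_m q))) mM subrr.
  - rewrite (psiB _ _ _ _ (psi_h _) (psiB _ _ _ _ (psiM' _ _ _ _ (psi_h p) (psi_h q))
      (psiM' _ _ _ _ (psi_h q) (psi_h p)))).
    by rewrite hbr subrr.
  - rewrite (psiB _ _ _ _ (psi_h _) (psiD _ _ _ _ (psiM' _ _ _ _ (psi_m q) (psi_h p))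
      (psiM' _ _ _ _ (psi_m p) (psi_h q)))).
    by rewrite hM subrr.
  - rewrite (psiB _ _ _ _ (psi_m _) (psiB _ _ _ _ (psiM' _ _ _ _ (psi_h p) (psi_m q))
      (psiM' _ _ _ _ (psi_m q) (psi_h p)))).
    by rewrite mbr subrr.
  - by rewrite (psiB _ _ _ _ (psi_m _) psi1) m1 subrr.
have /choice[f phi_f] := surj_phi.
have psi_f u g : phi g = u -> psi (f u) = psi g.
  move=> phi_g; apply/eqP; rewrite -subr_eq0 -(psiB _ _ _ _ erefl erefl).
  apply/eqP/ker/ker_phi.
  by rewrite (linearB phi) /= phi_f phi_g subrr.
exists (fun u => psi (f u)); split=> [c u v||u v|a|a].
- rewrite -lin_psi; apply: psi_f; by rewrite (linearP phi) /= !phi_f.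
- by rewrite -psi1; apply: psi_f; rewrite rmorph1.
- by rewrite -psiM; apply: psi_f; rewrite (rmorphM phi) /= !phi_f.
- by rewrite -psi_m; exact: psi_f.
- by rewrite -psi_h; exact: psi_f.
Qed.

End UniversalProperty.

(** * Coefficient families as a module *)

#[local] Obligation Tactic := idtac.

Section EndomorphismAlgebra.
Variables (k : fieldType) (Q : fieldAlgType k) (I : Type).
Local Notation M := (seq I -> Q).

(** The [k]-linear endomorphisms of the space of all functions from words to [Q]; no
finiteness of supports is needed to act on coefficient families. *)
Record wordEnd := WordEnd {
  endo_fun :> M -> M;
  endo_linear : forall (c : k) (f g : M) w,
    endo_fun (fun z => c *: f z + g z) w = c *: endo_fun f w + endo_fun g w }.

HB.instance Definition _ := gen_eqMixin wordEnd.
HB.instance Definition _ := gen_choiceMixin wordEnd.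

Lemma endoP (X Y : wordEnd) : (forall f w, X f w = Y f w) -> X = Y.
Proof.
case: X Y => [X linX] [Y linY] /= eqXY.
have {}eqXY : X = Y by apply/funext => f; apply/funext => w; exact: eqXY.
by move: linX; rewrite eqXY => linX; congr WordEnd; exact: Prop_irrelevance.
Qed.

Lemma endo_ext (X : wordEnd) f g w : f =1 g -> X f w = X g w.
Proof. by move=> /funext->. Qed.

Lemma endoD (X : wordEnd) f g w : X (fun z => f z + g z) w = X f w + X g w.
Proof.
rewrite -[X in X + _]scale1r -endo_linear; apply: endo_ext => z.
by rewrite scale1r.
Qed.

Lemma endo0 (X : wordEnd) w : X (fun=> 0) w = 0.
Proof. by apply: (addrI (X (fun=> 0) w)); rewrite -endoD !addr0. Qed.

Lemma endoZ (X : wordEnd) c f w : X (fun z => c *: f z) w = c *: X f w.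
Proof.
rewrite -[RHS]addr0 -(endo0 X w) -endo_linear; apply: endo_ext => z.
by rewrite addr0.
Qed.

Program Definition endo_zero := @WordEnd (fun _ _ => 0) _.
Next Obligation. by move=> *; rewrite scaler0 addr0. Qed.
Program Definition endo_opp (X : wordEnd) := @WordEnd (fun f w => - X f w) _.
Next Obligation. by move=> X c f g w /=; rewrite endo_linear opprD scalerN. Qed.
Program Definition endo_add (X Y : wordEnd) := @WordEnd (fun f w => X f w + Y f w) _.
Next Obligation. by move=> X Y c f g w /=; rewrite !endo_linear scalerDr addrACA. Qed.
Program Definition endo_one := @WordEnd (fun f w => f w) _.
Next Obligation. by []. Qed.
Program Definition endo_mul (X Y : wordEnd) := @WordEnd (fun f w => X (Y f) w) _.
Next Obligation.
move=> X Y c f g w /=; rewrite -endo_linear; apply: endo_ext => z.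
exact: endo_linear.
Qed.
Program Definition endo_scale (a : k) (X : wordEnd) := @WordEnd (fun f w => a *: X f w) _.
Next Obligation.
by move=> a X c f g w /=; rewrite endo_linear scalerDr !scalerA mulrC.
Qed.

Fact endo_addA : associative endo_add.
Proof. by move=> X Y Z; apply: endoP => f w /=; rewrite addrA. Qed.
Fact endo_addC : commutative endo_add.
Proof. by move=> X Y; apply: endoP => f w /=; rewrite addrC. Qed.
Fact endo_add0 : left_id endo_zero endo_add.
Proof. by move=> X; apply: endoP => f w /=; rewrite add0r. Qed.
Fact endo_addN : left_inverse endo_zero endo_opp endo_add.
Proof. by move=> X; apply: endoP => f w /=; rewrite addNr. Qed.
HB.instance Definition _ :=
  GRing.isZmodule.Build wordEnd endo_addA endo_addC endo_add0 endo_addN.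

Fact endo_mulA : associative endo_mul.
Proof. by move=> X Y Z; apply: endoP. Qed.
Fact endo_mul1l : left_id endo_one endo_mul.
Proof. by move=> X; apply: endoP. Qed.
Fact endo_mul1r : right_id endo_one endo_mul.
Proof. by move=> X; apply: endoP. Qed.
Fact endo_mulDl : left_distributive endo_mul endo_add.
Proof. by move=> X Y Z; apply: endoP. Qed.
Fact endo_mulDr : right_distributive endo_mul endo_add.
Proof. by move=> X Y Z; apply: endoP => f w /=; rewrite -endoD. Qed.
Fact endo_nonzero : endo_one != 0 :> wordEnd.
Proof.
apply/eqP => /(congr1 (fun X : wordEnd => X (fun=> 1) [::])) /= /eqP.
by rewrite oner_eq0.
Qed.
HB.instance Definition _ := GRing.Zmodule_isNzRing.Build wordEnd
  endo_mulA endo_mul1l endo_mul1r endo_mulDl endo_mulDr endo_nonzero.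

Fact endo_scaleA a b X : endo_scale a (endo_scale b X) = endo_scale (a * b) X.
Proof. by apply: endoP => f w /=; rewrite scalerA. Qed.
Fact endo_scale1 : left_id 1 endo_scale.
Proof. by move=> X; apply: endoP => f w /=; rewrite scale1r. Qed.
Fact endo_scaleDr : right_distributive endo_scale +%R.
Proof. by move=> a X Y; apply: endoP => f w /=; rewrite scalerDr. Qed.
Fact endo_scaleDl X : {morph endo_scale^~ X : a b / a + b}.
Proof. by move=> a b; apply: endoP => f w /=; rewrite scalerDl. Qed.
HB.instance Definition _ := GRing.Zmodule_isLmodule.Build k wordEnd
  endo_scaleA endo_scale1 endo_scaleDr endo_scaleDl.

Fact endo_scaleAl (a : k) (X Y : wordEnd) : a *: (X * Y) = (a *: X) * Y.
Proof. by apply: endoP. Qed.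
HB.instance Definition _ := GRing.Lmodule_isLalgebra.Build k wordEnd endo_scaleAl.
Fact endo_scaleAr (a : k) (X Y : wordEnd) : a *: (X * Y) = X * (a *: Y).
Proof. by apply: endoP => f w /=; rewrite -endoZ. Qed.
HB.instance Definition _ := GRing.Lalgebra_isAlgebra.Build k wordEnd endo_scaleAr.

End EndomorphismAlgebra.

Section CoordinateAction.
Variables (k : fieldType) (n : nat) (Q : fieldAlgType k) (br : Q -> Q -> Q).
Variable x : 'I_n -> Q.
Local Notation E := (wordEnd Q 'I_n).
Hypothesis poisson_br : poisson_bracket br.
Let lie_br := poisson_lie poisson_br.

Program Definition coef_mul (a : Q) : E := @WordEnd _ _ _ (fun f w => a * f w) _.
Next Obligation. by move=> a c f g w /=; rewrite mulrDr scalerAr. Qed.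

Fact coef_mul_linear : linear coef_mul.
Proof. by move=> c a b; apply: endoP => f w /=; rewrite mulrDl scalerAl. Qed.
Fact coef_mulM : monoid_morphism coef_mul.
Proof.
by split=> [|a b]; apply: endoP => f w /=; rewrite ?mul1r ?mulrA.
Qed.
HB.instance Definition _ := GRing.isLinear.Build k Q E *:%R coef_mul coef_mul_linear.
HB.instance Definition _ := GRing.isMonoidMorphism.Build Q E coef_mul coef_mulM.

Definition shift (i : 'I_n) (f : seq 'I_n -> Q) (w : seq 'I_n) : Q :=
  if w is j :: w' then (if j == i then f w' else 0) else 0.

(** The effect of left multiplication by [h_{x_i}] on coefficients, dictated by
[h_{x_i} a w = a (i :: w) + {x_i, a} w]. *)
Program Definition var_mul (i : 'I_n) : E :=
  @WordEnd _ _ _ (fun f w => br (x i) (f w) + shift i f w) _.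
Next Obligation.
move=> i c f g w /=; rewrite (lieDr lie_br) (lieZr lie_br) scalerDr addrACA.
congr (_ + _); case: w => [|j w] /=; first by rewrite scaler0 addr0.
by case: eqP => // _; rewrite scaler0 addr0.
Qed.

Lemma var_mul_commutes i a : commutator (var_mul i) (coef_mul a) = coef_mul (br (x i) a).
Proof.
apply: endoP => f w /=; rewrite (poisson_leibniz poisson_br).
have -> : shift i (fun z => a * f z) w = a * shift i f w.
  by case: w => [|j w] /=; rewrite ?mulr0 //; case: eqP; rewrite ?mulr0.
by rewrite mulrDr -[_ + _ + a * shift _ _ _]addrA addrK.
Qed.

End CoordinateAction.

(** * The word basis *)

Section WordBasis.
Variables (k : fieldType) (n : nat) (Q : fieldAlgType k) (br : Q -> Q -> Q).
Variables (x : 'I_n -> Q) (U : algType k) (m : {lrmorphism Q -> U}) (h : Q -> U).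
Hypothesis poisson_br : poisson_bracket br.
Let lie_br := poisson_lie poisson_br.
Local Notation hw := (hword h x).
Implicit Types (c : malg (seq 'I_n) Q) (w z : seq 'I_n).

Definition hsum c : U := \sum_(w <- msupp c) m (mcoeff w c) * hw w.

Lemma hsumD c c' : hsum (c + c') = hsum c + hsum c'.
Proof. exact: (raddfD (mmap m hw)). Qed.

Lemma hsum0 : hsum 0 = 0.
Proof. exact: (raddf0 (mmap m hw)). Qed.

Lemma hsumU q w : hsum (mkmalgU w q) = m q * hw w.
Proof. exact: (mmapU (f := m) (h := hw)). Qed.

(** The left [Q]-span of the words.  It is a subring, because coefficients can be moved
to the left of the [h (x i)]. *)
Definition hspan (u : U) : Prop := exists c, u = hsum c.

Lemma hspanD u v : hspan u -> hspan v -> hspan (u + v).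
Proof. by move=> [c ->] [c' ->]; exists (c + c'); rewrite hsumD. Qed.

Lemma hspanU q w : hspan (m q * hw w).
Proof. by exists (mkmalgU w q); rewrite hsumU. Qed.

Lemma hspan_sum (T : eqType) (r : seq T) (F : T -> U) :
  (forall t, t \in r -> hspan (F t)) -> hspan (\sum_(t <- r) F t).
Proof.
move=> H; rewrite big_seq; elim/big_ind: _ => //; last exact: hspanD.
by exists 0; rewrite hsum0.
Qed.

Lemma hspan_m q u : hspan u -> hspan (m q * u).
Proof.
move=> [c ->]; rewrite mulr_sumr; apply: hspan_sum => w _.
by rewrite mulrA -(rmorphM m); exact: hspanU.
Qed.

Lemma hspanZ a u : hspan u -> hspan (a *: u).
Proof.
move=> Su; have -> : a *: u = m a%:A * u by rewrite linearZ /= rmorph1 -scalerAl mul1r.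
exact: hspan_m.
Qed.

Lemma hspanN u : hspan u -> hspan (- u).
Proof. by move=> Su; rewrite -scaleN1r; exact: hspanZ. Qed.

Hypothesis h_m : forall i a, h (x i) * m a = m a * h (x i) + m (br (x i) a).

Lemma hspan_h i u : hspan u -> hspan (h (x i) * u).
Proof.
move=> [c ->]; rewrite mulr_sumr; apply: hspan_sum => w _.
rewrite mulrA h_m mulrDl -mulrA; apply: hspanD; last exact: hspanU.
by have := hspanU (mcoeff w c) (i :: w); rewrite /hword big_cons.
Qed.

Lemma hspanM u v : hspan u -> hspan v -> hspan (u * v).
Proof.
move=> [c ->] Sv; rewrite mulr_suml; apply: hspan_sum => w _.
rewrite -mulrA; apply: hspan_m; elim: w => [|i w IH].
  by rewrite /hword big_nil mul1r.
by rewrite /hword big_cons -mulrA; exact: hspan_h.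
Qed.

Lemma hspan1 : hspan 1.
Proof. by have := hspanU 1 [::]; rewrite rmorph1 /hword big_nil mulr1. Qed.

Lemma hspan_mem_m a : hspan (m a).
Proof. by rewrite -[m a]mulr1; exact/hspan_m/hspan1. Qed.

Lemma hspan_mem_h i : hspan (h (x i)).
Proof. by rewrite -[h _]mulr1; exact/hspan_h/hspan1. Qed.

Hypothesis span : forall u, hspan u.
Variable C : U -> seq 'I_n -> Q.
Hypothesis C_sub : forall u v w, C (u - v) w = C u w - C v w.
Hypothesis C_one : forall w, C 1 w = (w == [::])%:R.
Hypothesis C_m : forall a u w, C (m a * u) w = a * C u w.
Hypothesis C_h : forall i u w, C (h (x i) * u) w = br (x i) (C u w) + shift i (C u) w.

Lemma hcoef0 w : C 0 w = 0.
Proof. by rewrite -(subrr (0 : U)) C_sub subrr. Qed.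

Lemma hcoefD u v w : C (u + v) w = C u w + C v w.
Proof. by rewrite -[in LHS](opprK v) C_sub -[- v]sub0r C_sub hcoef0 sub0r opprK. Qed.

Lemma hcoef_sum (T : Type) (r : seq T) (P : pred T) (F : T -> U) w :
  C (\sum_(t <- r | P t) F t) w = \sum_(t <- r | P t) C (F t) w.
Proof.
by apply: (big_morph (fun u => C u w)) => [u v|]; [exact: hcoefD | exact: hcoef0].
Qed.

Lemma br_nat a (b : bool) : br a b%:R = 0.
Proof.
case: b; last exact: lie0r lie_br a.
have := poisson_leibniz poisson_br a 1 1; rewrite !mulr1 mul1r => /eqP.
by rewrite -subr_eq0 opprD addNKr oppr_eq0 => /eqP.
Qed.

Lemma hcoef_hword v w : C (hw v) w = (w == v)%:R.
Proof.
elim: v w => [|i v IH] w; first by rewrite /hword big_nil C_one.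
rewrite /hword big_cons -/(hw v) C_h IH br_nat add0r.
case: w => [|j w] //=; rewrite IH eqseq_cons.
by case: eqP.
Qed.

Lemma hcoef_hsum c w : C (hsum c) w = mcoeff w c.
Proof.
rewrite hcoef_sum (eq_bigr (fun v => mcoeff v c * (w == v)%:R)) => [|v _]; last first.
  by rewrite C_m hcoef_hword.
case: (msuppP c w) => [wc|wc].
  rewrite (big_fsetD1 w) //= eqxx mulr1 big_seq big1 ?addr0 // => v.
  by rewrite in_fsetD1 eq_sym => /andP[/negPf-> _]; rewrite mulr0.
rewrite big_seq big1 // => v vc; case: eqP => [E|]; last by rewrite mulr0.
by move: wc; rewrite E vc.
Qed.

(** Moving the coefficients of [s] to the left of [v] only creates terms shorter than
[size v + b]. *)
Lemma hword_mul v s b : degree_below C b.+1 s ->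
  degree_below C (size v + b).+1 (hw v * s) /\
  forall z, size z = (size v + b)%N ->
    C (hw v * s) z = (take (size v) z == v)%:R * C s (drop (size v) z).
Proof.
move=> sb; elim: v => [|i v [IH1 IH2]].
  rewrite /hword big_nil mul1r add0n; split=> // z _.
  by rewrite take0 drop0 mul1r.
have E z : (size v + b < size z)%N ->
    C (hw (i :: v) * s) z = shift i (C (hw v * s)) z.
  move=> lt_z; rewrite /hword big_cons -mulrA C_h -/(hw v) IH1 //.
  by rewrite (lie0r lie_br) add0r.
split=> [z lt_z|z size_z].
  rewrite E; last exact: ltnW.
  case: z lt_z => [|j z] //= lt_z; case: eqP => // _; exact: IH1.
rewrite E ?size_z //; case: z size_z => [|j z] //= [size_z].
by rewrite IH2 // eqseq_cons; case: eqP => _; rewrite ?mul0r.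
Qed.

Lemma word_leading_calculus : leading_calculus C.
Proof.
split=> [|u|u|N f|a b u v].
- exact: C_sub.
- have [c ->] := span u; exists (\max_(w <- msupp c) size w).+1.
  apply/asboolP => w lt_w; rewrite hcoef_hsum; apply: mcoeff_outdom.
  by apply/negP => wc; move: lt_w; rewrite ltnNge leq_bigmax_seq.
- have [c ->] := span u => H; suff -> : c = 0 by rewrite hsum0.
  by apply/malgP => w; rewrite -hcoef_hsum H ?mcoeff0.
- exists (\sum_(z : N.-tuple 'I_n) m (f z) * hw z); split=> w size_w.
    rewrite hcoef_sum big1 // => z _; rewrite C_m hcoef_hword.
    case: eqP => [E|]; last by rewrite mulr0.
    by move: size_w; rewrite E size_tuple ltnn.
  rewrite hcoef_sum (bigD1 (Tuple (introT eqP size_w))) //= C_m hcoef_hword eqxx mulr1.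
  rewrite big1 ?addr0 // => z; rewrite C_m hcoef_hword -val_eqE eq_sym /= => /negPf->.
  by rewrite mulr0.
move=> ua vb; have [c def_u] := span u.
have le_c w : w \in msupp c -> (size w <= a)%N.
  rewrite leqNgt -mcoeff_neq0 -hcoef_hsum -def_u; apply: contraNN => lt_w.
  by rewrite ua.
have sumE z : C (u * v) z = \sum_(w <- msupp c) C u w * C (hw w * v) z.
  rewrite {1}def_u mulr_suml hcoef_sum; apply: eq_bigr => w _.
  by rewrite -mulrA C_m -hcoef_hsum -def_u.
split=> z size_z; rewrite sumE.
  rewrite big_seq big1 // => w /le_c le_w.
  by rewrite (hword_mul w vb).1 ?mulr0 //; lia.
have term w : w \in msupp c ->
    C u w * C (hw w * v) z = C u w * (w == take a z)%:R * C v (drop a z).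
  move=> /le_c; rewrite leq_eqVlt => /orP[/eqP size_w|lt_w].
    by rewrite (hword_mul w vb).2 ?size_w // eq_sym mulrA.
  rewrite (hword_mul w vb).1; last by lia.
  case: eqP => [E|]; rewrite ?mulr0 ?mul0r //.
  by exfalso; move: lt_w; rewrite E size_take_min size_z; lia.
rewrite big_seq (eq_bigr _ (fun w wc => term w wc)) -big_seq -mulr_suml; congr (_ * _).
rewrite {2}def_u hcoef_hsum.
case: (msuppP c (take a z)) => [zc|zc].
  rewrite (big_fsetD1 (take a z)) //= eqxx mulr1 big_seq big1 ?addr0 => [|w].
    by rewrite def_u hcoef_hsum.
  by rewrite in_fsetD1 => /andP[/negPf-> _]; rewrite mulr0.
rewrite big_seq big1 // => w wc; case: eqP => [E|]; last by rewrite mulr0.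
by move: zc; rewrite -E wc.
Qed.

Lemma hdeg_edeg : hdeg m h x = edeg word_leading_calculus.
Proof.
apply/funext => u; rewrite /hdeg.
set c := xget 0 (hexpansion m h x u).
have def_u : u = hsum c.
  apply: (@xgetPex _ 0 (hexpansion m h x u)).
  by have [c' def] := span u; exists c'.
have cE w : mcoeff w c = C u w by rewrite [in RHS]def_u hcoef_hsum.
rewrite /edeg; have [u0|nz_u] := eqVneq u 0.
  have -> : c = 0 by apply/malgP => w; rewrite cE u0 hcoef0 mcoeff0.
  by rewrite msupp0 big_seq_fset0.
have [w size_w nz_w] := sz_top word_leading_calculus nz_u.
apply/eqP; rewrite eq_le; apply/andP; split.
  rewrite big_seq; apply: bigmax_le => [|v vc]; first exact: leNye.
  rewrite lee_fin lez_nat -ltnS prednK ?sz_gt0 // ltnNge.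
  apply/negP => /(sz_below (HC := word_leading_calculus)) => /eqP.
  by rewrite -cE mcoeff_eq0 vc.
rewrite -size_w; apply: (@le_bigmax_seq _ _ _ _ _ w) => //.
by rewrite -mcoeff_neq0 cE.
Qed.

End WordBasis.

Section Enveloping.
Variables (k : fieldType) (n : nat) (Q : fieldAlgType k) (br : Q -> Q -> Q).
Variables (x : 'I_n -> Q) (U : algType k) (m h : Q -> U).
Hypothesis hQ : free_poisson_field br x.
Hypothesis hU : universal_enveloping br m h.

Lemma free_poisson_field_bracket : poisson_bracket br.
Proof. by have [g [brg [xg [I [e [v [brP [iota [_ _ _ _ []]]]]]]]]] := hQ. Qed.

Lemma coordinate_action (pQ : poisson_bracket br) : exists rho : U -> wordEnd Q 'I_n,
  [/\ linear rho, rho 1 = 1, forall u v, rho (u * v) = rho u * rho v,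
      forall a, rho (m a) = coef_mul n a &
      forall i, rho (h (x i)) = var_mul x pQ i].
Proof.
have [g [brg [xg [I [e [v [brP [iota [fg [be mh ev] bP fQ [_ bi xv]]]]]]]]]] := hQ.
pose mm : {lrmorphism Q -> wordEnd Q 'I_n} := @coef_mul k n Q.
have [hE [[lin_h leib_h] h_x h_m h_br]] := enveloping_derivation fg be mh ev bP fQ pQ
  bi xv (mm := mm) (var_mul_commutes x pQ).
have [||rho [linr rho1 rhoM rho_m rho_h]] := env_lift hU (mE := mm) (hE := hE).
- split=> [c a b|||a b]; [exact: linearP | exact: lin_h | exact: rmorph1 |
    exact: rmorphM].
- split=> [a b|a b|a b]; [exact: h_br | by rewrite leib_h addrC | by rewrite -h_m].
by exists rho; split=> // i; rewrite rho_h h_x.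
Qed.

(** The words span a subring that contains the coefficients and the [h (x i)].  It
contains [h a] for [a] in [g], since [h] turns brackets into commutators, and then
for every [a], since [h] is a derivation and coefficients are invertible. *)
Lemma env_spanned (mL : {lrmorphism Q -> U}) : mL =1 m -> forall u, hspan x mL h u.
Proof.
move=> mE; have [[linm linh m1 mM] [h_br hM m_br]] := env_relations hU.
have h_m i a : h (x i) * mL a = mL a * h (x i) + mL (br (x i) a).
  by rewrite !mE m_br addrC subrK.
have SD := @hspanD _ _ _ x U mL h; have SZ := @hspanZ _ _ _ x U mL h.
have SM := hspanM h_m.
apply: (env_generated hU) => [|c u v Su Sv|u v|a|a].
- exact: hspan1.
- by apply: SD => //; exact: SZ.
- exact: SM.
- by rewrite -mE; exact: hspan_mem_m.
have [g [brg [xg [I [e [v [brP [iota [fg [be mh ev] bP fQ [pQ bi xv]]]]]]]]]] := hQ.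
have h0 : h 0 = 0 by exact: linear_map0.
have S0 : hspan x mL h 0 by exists 0; rewrite hsum0.
move: a; apply: (fraction_field_ind fQ) => [|c p q Sp Sq|p q Sp Sq|a b q Sa Sb nz_b def_a|i].
- have := hM 1 1; rewrite mulr1 m1 mul1r => /eqP.
  by rewrite -subr_eq0 opprD addNKr oppr_eq0 => /eqP->.
- by rewrite linh; apply: SD => //; exact: SZ.
- by rewrite hM -!mE; apply: SD; exact: hspan_m.
- have -> : h q = mL b^-1 * (h a - mL q * h b).
    by rewrite -def_a hM -!mE addrK mulrA -(rmorphM mL) mulVf // rmorph1 mul1r.
  by apply/hspan_m/SD => //; apply/hspanN/hspan_m.
have [lin [lin_e lin_br lin_x]] := lie_embedding fg be ev bP pQ bi xv.
rewrite -lin_e; move: (e i); apply: (lie_generated_ind be mh).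
- by rewrite linear0 h0.
- move=> c u w Su Sw; rewrite (linearP lin) linh; apply: SD => //; exact: SZ.
- by move=> u w Su Sw; rewrite lin_br h_br; apply: SD; [|apply: hspanN]; exact: SM.
- by move=> j; rewrite lin_x; exact: hspan_mem_h.
Qed.

(** The coefficient of [u] at [w] is the value at [w] of [u] acting on the indicator
function of the empty word.  The existence of this action is the linear
independence of the words. *)
Lemma enveloping_calculus : exists (C : U -> seq 'I_n -> Q) (HC : leading_calculus C),
  hdeg m h x = edeg HC.
Proof.
have pQ := free_poisson_field_bracket.
have [[linm linh m1 mM] [h_br hM m_br]] := env_relations hU.
pose mlin := GRing.isLinear.Build _ _ _ _ m linm.
pose mmul := GRing.isMonoidMorphism.Build _ _ m (m1, mM).
pose mL : {lrmorphism Q -> U} := HB.pack m mlin mmul.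
have span := env_spanned (mL := mL) (fun=> erefl).
have [rho [lin_rho rho1 rhoM rho_m rho_x]] := coordinate_action pQ.
pose vac (w : seq 'I_n) : Q := (w == [::])%:R.
pose C u w := rho u vac w.
have C_sub u v w : C (u - v) w = C u w - C v w.
  by rewrite /C (linear_mapD lin_rho) (linear_mapN lin_rho).
have C_one w : C 1 w = (w == [::])%:R by rewrite /C rho1.
have C_m a u w : C (mL a * u) w = a * C u w by rewrite /C rhoM rho_m.
have C_h i u w : C (h (x i) * u) w = br (x i) (C u w) + shift i (C u) w.
  by rewrite /C rhoM rho_x.
exists C, (word_leading_calculus pQ span C_sub C_one C_m C_h).
exact: (hdeg_edeg pQ span C_sub C_one C_m C_h).
Qed.

End Enveloping.

Theorem theorem1 (k : fieldType) (hk : [pchar k] =i pred0) (n : nat)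
  (Q : fieldAlgType k) (br : Q -> Q -> Q) (x : 'I_n -> Q)
  (hQ : free_poisson_field br x)
  (U : algType k) (m h : Q -> U) (hU : universal_enveloping br m h) :
  weak_algorithm (hdeg m h x) /\ free_ideal_ring U.
Proof.
have [C [HC ->]] := enveloping_calculus hQ hU.
exact: leading_weak_algorithm_fir.
Qed.
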